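(* Let $n\ge1$, $1\le M\le n$, and let $\underline{s}\in\mathbb{R}^n$ with $s_i>\frac12$ for $i\neq M$ and $s_M>0$. The mean function of the Wishart family $(\gamma^{(M)}_{\underline{s},y})_{y\in P_G}$ on $Q_G$ is $$m^{(M)}_{\underline{s}}(y)=\pi\Bigl(\sum_{i=1}^{M-1}(s_i-s_{i+1})[(y_{\{1:i\}})^{-1}]^0+s_My^{-1}+\sum_{i=M+1}^{n}(s_i-s_{i-1})[(y_{\{i:n\}})^{-1}]^0\Bigr),\qquad y\in P_G.$$
   Context: $G=A_n$ is the path graph $1-2-\cdots-n$ on $V=\{1,\dots,n\}$; $E=\{(i,j): |i-j|\le 1\}$. $S_n$ is the space of real symmetric $n\times n$ matrices, $Z_G=\{y\in S_n:y_{ij}=0\text{ if }(i,j)\notin E\}$; $P_G$ is the set of positive definite $y\in Z_G$. $I_G$ is the dual space of $Z_G$, realised as the space of incomplete symmetric matrices $\eta=(\eta_{ij})_{(i,j)\in E}$, with $\langle y,\eta\rangle=\mathrm{tr}(y\eta)=\sum_{(i,j)\in E}y_{ij}\eta_{ij}$. $Q_G=\{\eta\in I_G:\langle y,\eta\rangle>0\ \forall y\in\overline{P_G}\setminus\{0\}\}$. $\pi:S_n\to I_G$ keeps the entries indexed by $E$. $d\eta$ is Lebesgue measure on $I_G$. For $I\subset V$, a subscript $I$ denotes the submatrix with rows and columns in $I$; $\{i:j\}=\{i,\dots,j\}$; $|\cdot|$ is the determinant. For a matrix $K$ indexed by $B\subset V$, $K^0$ is the $n\times n$ matrix with $(K^0)_{ij}=K_{ij}$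 if $i,j\in B$ and $0$ otherwise. With $s_0=s_{n+1}=0$, for $\eta\in Q_G$, $$\delta^{(M)}_{\underline{s}}(\eta)=\frac{\prod_{i=1}^{M-1}|\eta_{\{i:i+1\}}|^{s_i}\prod_{i=M+1}^{n}|\eta_{\{i-1:i\}}|^{s_i}}{\prod_{i=2}^{M-1}\eta_{ii}^{s_{i-1}}\cdot\eta_{MM}^{s_{M-1}-s_M+s_{M+1}}\cdot\prod_{i=M+1}^{n-1}\eta_{ii}^{s_{i+1}}};$$ $\varphi_{A_1}(\eta)=\eta^{-1}$, and for $n\ge2$, $\varphi_{A_n}(\eta)=\prod_{i=1}^{n-1}|\eta_{\{i,i+1\}}|^{-3/2}\prod_{i=2}^{n-1}\eta_{ii}$. For $y\in P_G$, $\gamma^{(M)}_{\underline{s},y}$ is the probability measure on $Q_G$ with density proportional to $e^{-\mathrm{tr}(y\eta)}\delta^{(M)}_{\underline{s}}(\eta)\varphi_{A_n}(\eta)$ with respect to $d\eta$. Its mean function is $m^{(M)}_{\underline{s}}(y)=\int_{Q_G}\eta\,\gamma^{(M)}_{\underline{s},y}(d\eta)$. *)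

(* Defs.v *)
From HB Require Import structures.
From mathcomp Require Import all_boot all_order all_algebra.
From mathcomp Require Import all_classical all_reals all_analysis.
Import Order.TTheory GRing.Theory Num.Theory.
Import numFieldNormedType.Exports.

Set Implicit Arguments.
Unset Strict Implicit.
Unset Printing Implicit Defensive.

Local Open Scope classical_set_scope.
Local Open Scope ring_scope.

(* The library's own instance of this fact is shadowed by its instance for
   products of subprobabilities. *)
Lemma sigma_finite_prod d1 d2 (T1 : measurableType d1) (T2 : measurableType d2)
    (R : realType) (m1 : {sigma_finite_measure set T1 -> \bar R})
    (m2 : {sigma_finite_measure set T2 -> \bar R}) :
  sigma_finite setT (m1 \x m2)%E.
Proof.
have /sigma_finiteP[F [TF ndF Foo]] := sigma_finiteT m1.
have /sigma_finiteP[G [TG ndG Goo]] := sigma_finiteT m2.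
exists (fun n => F n `*` G n).
  rewrite -setXTT TF TG predeqE => -[x y]; split.
    move=> [/= [n _ Fnx] [k _ Gky]]; exists (maxn n k) => //; split.
    - by move: x Fnx; exact/subsetPset/ndF/leq_maxl.
    - by move: y Gky; exact/subsetPset/ndG/leq_maxr.
  by move=> [n _ []/= ? ?]; split; exists n.
move=> k; have [? ?] := Foo k; have [? ?] := Goo k.
split; first exact: measurableX.
by rewrite product_measure1E// lte_mul_pinfty// ge0_fin_numE.
Qed.

Section LebesgueTuple.
Local Open Scope ereal_scope.
Variable R : realType.

(* Lebesgue measure on R^n as an iterated product; the cases are plain set
   functions, the measure structure being established just below. *)
Fixpoint lebesgue_tuple (n : nat) :
    set (n.-tuple (measurableTypeR R)) -> \bar R :=
  match n with
  | 0 => \d_ [tuple]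
  | m.+1 => pushforward (@lebesgue_measure R \x @lebesgue_tuple m)
              (fun p => [tuple of p.1 :: p.2])
  end.

Let uncons m (t : m.+1.-tuple (measurableTypeR R)) :=
  (thead t, [tuple of behead t]).

Let measurable_uncons m : measurable_fun
  [set: m.+1.-tuple (measurableTypeR R)] (@uncons m).
Proof.
apply/measurable_fun_pairP; split => /=.
  exact: measurable_tnth.
exact: measurable_behead.
Qed.

Let measurable_pcons m : measurable_fun
  [set: measurableTypeR R * m.-tuple (measurableTypeR R)]
  (fun p => [tuple of p.1 :: p.2]).
Proof. exact: measurable_cons. Qed.

Let lebesgue_tuple_bundle n :
  exists m : {sigma_finite_measure set (n.-tuple (measurableTypeR R)) -> \bar R},
    lebesgue_tuple (n := n) = m.
Proof.
elim: n => [|n [m mE]] /=.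
  pose d : {measure set (0.-tuple (measurableTypeR R)) -> \bar R} := \d_ [tuple].
  have sd : sigma_finite setT d.
    apply: fin_num_fun_sigma_finite; first by rewrite measure0.
    by move=> U _; rewrite /d /= diracE.
  pose D : {sigma_finite_measure set (0.-tuple (measurableTypeR R)) -> \bar R} :=
    HB.pack (d : set _ -> \bar R) d (Measure_isSigmaFinite.Build _ _ _ d sd).
  by exists D.
pose nu := pushforward (@lebesgue_measure R \x m)
  (fun p : measurableTypeR R * n.-tuple (measurableTypeR R) =>
     [tuple of p.1 :: p.2]).
have nuF : sigma_finite setT nu.
  have [F FT Ffin] := sigma_finite_prod (@lebesgue_measure R) m.
  exists (fun i => @uncons n @^-1` F i).
    by rewrite -preimage_bigcup -FT preimage_setT.
  move=> i; have [mFi Fifin] := Ffin i; split.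
    by rewrite -[X in measurable X]setTI; exact: measurable_uncons.
  rewrite /nu /pushforward -comp_preimage.
  rewrite (_ : _ \o _ = id) ?preimage_id//.
  apply/funext => -[x t] /=; congr pair => //; exact/val_inj.
pose mnu : {measure set (n.+1.-tuple (measurableTypeR R)) -> \bar R} :=
  measure_function_pushforward__canonical__measure_function_Measure
    (@lebesgue_measure R \x m) (@measurable_pcons n).
pose N : {sigma_finite_measure set (n.+1.-tuple (measurableTypeR R)) -> \bar R} :=
  HB.pack (mnu : set _ -> \bar R) mnu
    (Measure_isSigmaFinite.Build _ _ _ mnu nuF).
by exists N; rewrite mE.
Qed.

Section instances.
Variable n : nat.
Local Notation leb := (@lebesgue_tuple n).

Let leb0 : leb set0 = 0.
Proof. by have [m ->] := lebesgue_tuple_bundle n. Qed.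

Let leb_ge0 A : 0 <= leb A.
Proof. by have [m ->] := lebesgue_tuple_bundle n; exact: measure_ge0. Qed.

Let leb_sigma_additive : semi_sigma_additive leb.
Proof.
have [m ->] := lebesgue_tuple_bundle n; exact: measure_semi_sigma_additive.
Qed.

HB.instance Definition _ := isMeasure.Build _ _ _ leb
  leb0 leb_ge0 leb_sigma_additive.

Let leb_sigma_finite : sigma_finite setT leb.
Proof.
have [m ->] := lebesgue_tuple_bundle n; exact: (sigma_finiteT m).
Qed.

HB.instance Definition _ := Measure_isSigmaFinite.Build _ _ _ leb
  leb_sigma_finite.

End instances.
End LebesgueTuple.

(** Vertices are the ordinals of 'I_n, the ordinal v standing for the vertex
    v.+1.  Numerical indices (i, j, M, the index of s_i) are 1-based. *)

Section PathGraph.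
Variables (R : realType) (n : nat).

Definition edge (u v : 'I_n) : bool := (u <= v.+1)%N && (v <= u.+1)%N.

Definition seg (i j : nat) : {set 'I_n} := [set v : 'I_n | i <= v.+1 <= j]%N%SET.

Definition psub (A : 'M[R]_n) (B : {set 'I_n}) : 'M[R]_#|B| :=
  mxsub (@enum_val _ (mem B)) (@enum_val _ (mem B)) A.

(* K^0, where the rows and columns of K are listed by the enumeration of B *)
Definition zext (B : {set 'I_n}) (K : 'M[R]_#|B|) : 'M[R]_n :=
  \matrix_(u, v)
    match [pick a : 'I_#|B| | enum_val a == u],
          [pick b : 'I_#|B| | enum_val b == v] with
    | Some a, Some b => K a b
    | _, _ => 0
    end.

Definition ZG : set 'M[R]_n :=
  [set y | y^T = y /\ forall u v, ~~ edge u v -> y u v = 0].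

Definition PG : set 'M[R]_n :=
  [set y | ZG y /\ forall x : 'cV[R]_n, x != 0 -> 0 < (x^T *m y *m x) 0 0].

(* An incomplete symmetric matrix: its diagonal (eta_11, ..., eta_nn) and its
   off-diagonal (eta_12, ..., eta_(n-1)n). *)
Definition IG : Type :=
  (n.-tuple (measurableTypeR R) * n.-1.-tuple (measurableTypeR R))%type.

HB.instance Definition _ := Measurable.on IG.

Definition leb_IG : set IG -> \bar R :=
  (@lebesgue_tuple R n \x @lebesgue_tuple R n.-1)%E.

HB.instance Definition _ := Measure.on leb_IG.
HB.instance Definition _ := Measure_isSigmaFinite.Build _ _ _ leb_IG
  (sigma_finite_prod (@lebesgue_tuple R n) (@lebesgue_tuple R n.-1)).

(* 0 is a dummy value for the unspecified entries *)
Definition entry (eta : IG) (u v : 'I_n) : R :=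
  if u == v then tnth eta.1 u
  else if edge u v then nth 0 eta.2 (minn u v)
  else 0.

Definition mx_of_IG (eta : IG) : 'M[R]_n := \matrix_(u, v) entry eta u v.

Definition edge_lo (e : 'I_n.-1) : 'I_n := widen_ord (leq_pred n) e.

Lemma edge_hi_subproof (e : 'I_n.-1) : (e.+1 < n)%N.
Proof. by rewrite -ltn_predRL ltn_ord. Qed.

Definition edge_hi (e : 'I_n.-1) : 'I_n := Ordinal (edge_hi_subproof e).

Definition IG_of (f : 'I_n -> 'I_n -> R) : IG :=
  ([tuple f v v | v < n], [tuple f (edge_lo e) (edge_hi e) | e < n.-1]).

Definition piG (A : 'M[R]_n) : IG := IG_of A.

Definition pairing (y : 'M[R]_n) (eta : IG) : R :=
  \sum_(p : 'I_n * 'I_n | edge p.1 p.2) y p.1 p.2 * entry eta p.1 p.2.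

Definition QG : set IG :=
  [set eta | forall y, closure PG y -> y != 0 -> 0 < pairing y eta].

(* eta_ii *)
Definition diag_entry (eta : IG) (i : nat) : R := nth 0 eta.1 i.-1.

(* |eta_{i:j}| *)
Definition minor (eta : IG) (i j : nat) : R :=
  \det (psub (mx_of_IG eta) (seg i j)).

(* s_i, with s_0 = s_(n+1) = 0 *)
Definition coef (s : n.-tuple R) (i : nat) : R := nth 0 (0 :: s) i.

Definition delta (M : nat) (s : n.-tuple R) (eta : IG) : R :=
  ((\prod_(1 <= i < M) minor eta i i.+1 `^ coef s i) *
   (\prod_(M.+1 <= i < n.+1) minor eta i.-1 i `^ coef s i)) /
  ((\prod_(2 <= i < M) diag_entry eta i `^ coef s i.-1) *
   diag_entry eta M `^ (coef s M.-1 - coef s M + coef s M.+1) *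
   (\prod_(M.+1 <= i < n) diag_entry eta i `^ coef s i.+1)).

Definition phi (eta : IG) : R :=
  if n == 1%N then (diag_entry eta 1)^-1
  else (\prod_(1 <= i < n) minor eta i i.+1 `^ (- (3 / 2))) *
       (\prod_(2 <= i < n) diag_entry eta i).

Definition is_wishart (M : nat) (s : n.-tuple R) (y : 'M[R]_n)
    (gamma : probability IG R) : Prop :=
  exists2 c : R, 0 < c & forall A : set IG, measurable A ->
    gamma A = (\int[leb_IG]_(eta in A `&` QG)
      (c * (expR (- pairing y eta) * delta M s eta * phi eta))%:E)%E.

Definition has_mean (gamma : probability IG R) : Prop :=
  forall u v : 'I_n, edge u v ->
    gamma.-integrable QG (fun eta => (entry eta u v)%:E).

Definition mean (gamma : probability IG R) : IG :=
  IG_of (fun u v => \int[gamma]_(eta in QG) entry eta u v).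

End PathGraph.

(* Main.v *)
Require Import Defs.
From HB Require Import structures.
From mathcomp Require Import all_boot all_order all_algebra.
From mathcomp Require Import all_classical all_reals all_analysis.
From mathcomp Require Import measurable_realfun.
From mathcomp Require Import ring lra zify.
Import Order.TTheory GRing.Theory Num.Theory.
Import numFieldNormedType.Exports.
Set Implicit Arguments.
Unset Strict Implicit.
Unset Printing Implicit Defensive.
Local Open Scope classical_set_scope.
Local Open Scope ring_scope.

(** Write [a_i] and [b_i] for the diagonal and off-diagonal entries of [eta], and
    [y_i], [z_i] for those of [y], so that the pairing is the sum of the
    [y_i a_i] plus twice the sum of the [z_i b_i].

    Orient the path towards the vertex [M].  On [QG], which is the set where all
    [a_i] and all [a_i a_(i+1) - b_i^2] are positive ([QGE]), the density is a
    product ([path_densityE]): the root contributes [a_M^(s_M - 1)], and an edge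
    between a vertex with entries [a], [b] and its parent with diagonal entry
    [c] contributes [(a c - b^2)^(s - 3/2) c^(1 - s)].  Integrating out the
    entries of a leaf is then a gamma integral followed by a Gaussian one, and
    gives [C y^(-s) exp (c z^2 / y)] ([edge_integral]).  This merely replaces
    the coefficient [y_p] of the parent by [y_p - z^2 / y], that is, performs one
    step of Gaussian elimination on [y].  Eliminating from both ends up to the
    root shows that the Laplace transform of the law is a constant times the
    product of the [pivot_i^(-s_i)] ([path_density_integral]).

    The mean is minus the gradient of the logarithm of that product.  There is
    no need to differentiate an integral: for a linear form [X] of [eta], the
    function [phi t = E exp (- t X)] is known near [0]; its finiteness makes [X]
    integrable, and [phi t >= 1 - t E X] with equality at [0].  A differentiable
    function that stays above a line and touches it has the slope of the line
    ([is_derive_supporting_line]), so [E X] is the derivative at [0] of the sum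
    of the [s_i ln pivot_i] along [y + t h].

    It remains to recognise this derivative.  Elimination shows that the inverse
    [U] of a positive definite tridiagonal matrix satisfies
    [U_(i,i+1) = - (z_i / l_i) U_(i+1,i+1)] and
    [U_(i,i) = 1 / l_i + (z_i / l_i)^2 U_(i+1,i+1)], where [l_i] is the pivot from
    the left, and symmetrically from the right.  The truncated inverses in the
    formula for the mean satisfy the same relations, with [0] in place of [1]
    outside their support, so the formula satisfies them with [1] replaced by
    the sum of the coefficients, which telescopes to [s_i] ([mean_mx_left],
    [mean_mx_right], [mean_mx_root]).  With these relations the derivative of the
    sum of the [s_i ln pivot_i] telescopes as well, to the pairing of [h] with
    the formula ([is_derive_log_pivots]). *)

(** * Integrals over the line *)

Section LineIntegrals.
Context {R : realType}.
Local Notation mu := (@lebesgue_measure R).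

Let affine_measurable (k b : R) :
  measurable_fun [set: R] ((fun x => k * x + b) : R -> measurableTypeR R).
Proof. by apply: measurable_funD => //; apply: measurable_funM. Qed.

(** Both sides agree on half-open intervals, which characterises Lebesgue measure. *)
Lemma lebesgue_measure_affine (k b : R) (k0 : 0 < k) (A : set R) :
  measurable A ->
  mu A = (k%:E * pushforward mu ((fun x => k * x + b)%R : _ -> measurableTypeR R) A)%E.
Proof.
move=> mA.
pose m : {measure set (measurableTypeR R) -> \bar R} :=
  measure_function_pushforward__canonical__measure_function_Measure
    mu (affine_measurable k b).
pose ms := mscale (NngNum (ltW k0)) m.
have -> // : mu A = ms A.
apply: lebesgue_measure_unique => //= _ [[u v]] _ <-.
rewrite /ms /mscale /m /= /pushforward.
rewrite [X in (_ * mu X)%E](_ : _ = [set` `](u - b) / k, (v - b) / k]]); last first.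
  apply/seteqP; split => x /=; rewrite !in_itv/= ltr_pdivrMr// ler_pdivlMr//;
   by rewrite ltrBlDr lerBrDr (mulrC x).
rewrite !lebesgue_measure_itv /= !lte_fin ltr_pM2r ?invr_gt0// ltrD2r.
case: ifPn => uv; last by rewrite mule0.
rewrite -EFinB -EFinM; congr EFin.
by field; rewrite gt_eqF.
Qed.

Lemma integral_affine (f : R -> \bar R) (k b : R) : 0 < k ->
  measurable_fun setT f -> (forall x, 0 <= f x)%E ->
  (\int[mu]_x f x = k%:E * \int[mu]_x f (k * x + b)%R)%E.
Proof.
move=> k0 mf f0.
pose m : {measure set (measurableTypeR R) -> \bar R} :=
  measure_function_pushforward__canonical__measure_function_Measure
    mu (affine_measurable k b).
rewrite (@eq_measure_integral _ _ _ _ (mscale (NngNum (ltW k0)) m)) => [|A mA _]; last first.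
  exact: lebesgue_measure_affine.
rewrite ge0_integral_mscale//.
rewrite ge0_integral_pushforward//=.
exact: affine_measurable.
Qed.

(** The gamma density with shape [t] and rate [y], without its constant. *)
Definition gamma_fun (t y x : R) : R :=
  if 0 < x then x `^ (t - 1) * expR (- (y * x)) else 0.

Lemma gamma_fun_ge0 t y x : 0 <= gamma_fun t y x.
Proof. by rewrite /gamma_fun; case: ifP => // _; rewrite mulr_ge0 ?powR_ge0 ?expR_ge0. Qed.

Lemma measurable_gamma_fun t y : measurable_fun setT (gamma_fun t y).
Proof.
apply: measurable_fun_ifT => //; first exact: measurable_fun_ltr.
apply: measurable_funM; first exact: measurable_powR.
apply: measurableT_comp => //; apply: measurableT_comp => //.
Qed.

(** Near [0] the integrand is unbounded when [t < 1]: the fundamental theorem of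
    calculus applies on [[1/(n+2), 1]] and gives a bound uniform in [n]. *)
Lemma integral_powR01 (t : R) : 0 < t ->
  (\int[mu]_(x in `]0%R, 1%R]) (x `^ (t - 1))%:E <= (t^-1)%:E)%E.
Proof.
move=> t0.
pose F (n : nat) := [set` `[n.+2%:R^-1 : R, 1]].
have -> : `]0, 1]%classic = \bigcup_n F n.
  apply/seteqP; split => x.
    rewrite /= in_itv/= => /andP[x0 x1].
    exists (Num.truncn x^-1) => //=; rewrite /F /= in_itv/= x1 andbT.
    rewrite invf_ple ?posrE// ltW// (lt_le_trans (truncnS_gt _))// ler_nat//.
  move=> [n _]; rewrite /F /= !in_itv/= => /andP[nx ->]; rewrite andbT.
  by rewrite (lt_le_trans _ nx)// invr_gt0.
have mf i : measurable_fun (F i) (fun x : R => (x `^ (t - 1))%:E).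
  by apply/measurable_EFinP; apply: measurable_funTS; exact: measurable_powR.
have ndF : nondecreasing_seq F.
  apply/nondecreasing_seqP => n; apply/subsetPset => x; rewrite /F /= !in_itv/= => /andP[nx ->].
  by rewrite andbT (le_trans _ nx)// lef_pV2 ?posrE// ler_nat.
have mF i : measurable (F i) by exact: measurable_itv.
have H : (\int[mu]_(x in F i) (x `^ (t - 1))%:E @[i --> \oo] -->
    \int[mu]_(x in \bigcup_i F i) (x `^ (t - 1))%:E)%E.
  by apply: ge0_nondecreasing_set_cvg_integral => // *; rewrite lee_fin powR_ge0.
rewrite -(cvg_lim _ H)//.
apply: lime_le; first by apply/cvg_ex; eexists; exact: H.
apply: nearW => n.
have n0 : 0 < n.+2%:R^-1 :> R by rewrite invr_gt0.
have pos (x : R) : n.+2%:R^-1 <= x -> 0 < x by exact: lt_le_trans.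
have n1 : n.+2%:R^-1 < 1 :> R by rewrite invf_lt1// ltr1n.
have dP (a x : R) : 0 < x -> {for x, continuous (@powR R ^~ a)}.
  move=> x0; apply: differentiable_continuous; apply/derivable1_diffP.
  by apply: derivable_powR; rewrite in_itv/= x0.
rewrite (@continuous_FTC2 _ _ (fun x => t^-1 * x `^ t)) //.
- by rewrite powR1 mulr1 -EFinB lee_fin lerBlDr lerDl mulr_ge0 ?invr_ge0 ?powR_ge0// ltW.
- apply/continuous_within_itvP => //; split.
  + by move=> x; rewrite in_itv/= => /andP[/ltW/pos x0 _]; exact: dP.
  + by apply: cvg_at_right_filter; apply: dP.
  + by apply: cvg_at_left_filter; apply: dP.
- split.
  + move=> x; rewrite in_itv/= => /andP[/ltW/pos x0 _].
    apply: derivableM => //; apply: derivable_powR; by rewrite in_itv/= x0.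
  + by apply: cvg_at_right_filter; apply: cvgM; [exact: cvg_cst|exact: dP].
  + by apply: cvg_at_left_filter; apply: cvgM; [exact: cvg_cst|exact: dP].
- move=> x; rewrite in_itv/= => /andP[/ltW/pos x0 _].
  rewrite derive1Ml; last by apply: derivable_powR; rewrite in_itv/= x0.
  rewrite powR_derive1 ?in_itv/= ?x0// mulrA mulVf ?mul1r// gt_eqF//.
Qed.

(** The power dominates near [0] and the exponential beyond [1]. *)
Lemma gamma_fun_le (t : R) : exists2 C : R, 0 < C & forall x,
  gamma_fun t 1 x <= \1_`]0, 1] x * x `^ (t - 1) + C * exponential_pdf 2^-1 x.
Proof.
pose p := `|t - 1| + 1.
have p0 : 0 < p by rewrite ltr_wpDl.
(* From [ln (x / (2 p)) <= x / (2 p)] one gets [x^p <= (2 p)^p exp (x / 2)]; the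
   factor 2 cancels the rate of the exponential density. *)
exists (2 * expR (p * ln (2 * p))).
  by rewrite mulr_gt0 ?expR_gt0.
move=> x; rewrite /gamma_fun; case: ifPn => [x0|_]; last first.
  rewrite addr_ge0 ?mulr_ge0 ?expR_ge0 ?powR_ge0 ?exponential_pdf_ge0//.
rewrite mul1r; case: (lerP x 1) => x1.
  rewrite indicE mem_set/= ?in_itv/= ?x0// mul1r ler_wpDr//.
    by rewrite !mulr_ge0 ?expR_ge0 ?exponential_pdf_ge0.
  by rewrite ler_piMr ?powR_ge0// -[leRHS]expR0 ler_expR oppr_le0 ltW.
apply: ler_wpDl; first by rewrite mulr_ge0 ?powR_ge0.
rewrite (exponential_pdfE _ (ltW x0)) mulrACA divff ?pnatr_eq0// mul1r -expRD mulNr.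
rewrite /powR gt_eqF// -expRD ler_expR.
have lx : 0 <= ln x by rewrite ln_ge0// ltW.
have : (t - 1) * ln x <= p * ln x.
  by rewrite ler_wpM2r// (le_trans (ler_norm _))// lerDl.
have p20 : 0 < 2 * p by rewrite mulr_gt0.
have : ln (x / (2 * p)) < x / (2 * p) by apply: ln_sublinear; rewrite divr_gt0.
rewrite ln_div ?posrE// => H1 H2.
have : p * (ln x - ln (2 * p)) <= 2^-1 * x.
  rewrite (_ : 2^-1 * x = p * (x / (2 * p))); last by field; rewrite gt_eqF.
  by rewrite ler_wpM2l ?ltW.
lra.
Qed.

Lemma gamma_integral_fin (t : R) : 0 < t ->
  (\int[mu]_x (gamma_fun t 1 x)%:E < +oo)%E.
Proof.
move=> t0; have [C C0 HC] := gamma_fun_le t.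
have me := @measurable_exponential_pdf R 2^-1.
have m1 : measurable_fun [set: R] (fun x : R => \1_`]0, 1] x * x `^ (t - 1)).
  by apply: measurable_funM => //; exact: measurable_powR.
apply: (@le_lt_trans _ _
  (\int[mu]_x ((\1_`]0, 1] x * x `^ (t - 1))%:E + (C * exponential_pdf 2^-1 x)%:E))%E).
  apply: ge0_le_integral => //=.
  - by move=> x _; rewrite lee_fin gamma_fun_ge0.
  - by apply/measurable_EFinP; exact: measurable_gamma_fun.
  - apply: emeasurable_funD; apply/measurable_EFinP => //; exact: measurable_funM.
  - by move=> x _; rewrite lee_fin.
have e0 (x : R) : 0 <= exponential_pdf 2^-1 x by exact: exponential_pdf_ge0.
rewrite ge0_integralD//=; last 4 first.
- by move=> x _; rewrite lee_fin mulr_ge0 ?powR_ge0.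
- exact/measurable_EFinP.
- by move=> x _; rewrite lee_fin mulr_ge0// ltW.
- apply/measurable_EFinP; exact: measurable_funM.
apply: lte_add_pinfty.
  apply: le_lt_trans (ltry t^-1); apply: le_trans (integral_powR01 t0).
  rewrite [leRHS]integral_mkcond; apply: ge0_le_integral => //=.
  - by move=> x _; rewrite lee_fin mulr_ge0 ?powR_ge0.
  - exact/measurable_EFinP.
  - apply/(measurable_restrictT _ _).1 => //.
    apply/measurable_EFinP; apply: measurable_funTS; exact: measurable_powR.
  - move=> x _; rewrite patchE indicE; case: ifPn => _; rewrite ?mul1r//.
    by rewrite mul0r.
under eq_integral do rewrite EFinM.
rewrite ge0_integralZl//=; last 3 first.
- exact/measurable_EFinP.
- by move=> x _; rewrite lee_fin.
- by rewrite lee_fin ltW.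
by rewrite integral_exponential_pdf ?invr_gt0// mule1 ltry.
Qed.

Lemma gamma_integral_gt0 (t : R) : 0 < t -> (0 < \int[mu]_x (gamma_fun t 1 x)%:E)%E.
Proof.
move=> t0.
pose c : R := Num.min (1 `^ (t - 1)) (2 `^ (t - 1)) * expR (- 2).
have c0 : 0 < c by rewrite mulr_gt0 ?expR_gt0// lt_min !powR_gt0.
apply: (@lt_le_trans _ _ (\int[mu]_(x in `[1%R, 2%R]) c%:E)%E).
  rewrite integral_cst//= lebesgue_measure_itv/= lte_fin ltr1n -EFinB -EFinM lte_fin.
  by rewrite mulr_gt0// subr_gt0 ltr1n.
rewrite [leLHS]integral_mkcond; apply: ge0_le_integral => //=.
- by move=> x _; rewrite erestrict_ge0// => ? _; rewrite lee_fin ltW.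
- exact/(measurable_restrictT _ _).1.
- apply/measurable_EFinP; exact: measurable_gamma_fun.
- move=> x _; rewrite patchE; case: ifPn; last by rewrite lee_fin gamma_fun_ge0.
  rewrite inE/= in_itv/= => /andP[x1 x2].
  have x0 : 0 < x by exact: lt_le_trans x1.
  rewrite lee_fin /gamma_fun x0 mul1r; apply: ler_pM => //.
  + rewrite ge_min; case: (lerP 0 (t - 1)) => t1.
      by apply/orP; left; apply: ge0_ler_powR; rewrite ?nnegrE ?(ltW x0).
    apply/orP; right; rewrite -[t - 1]opprK !(powRN _ (- (t - 1))).
    by rewrite lef_pV2 ?posrE ?powR_gt0//; apply: ge0_ler_powR; rewrite ?nnegrE ?oppr_ge0 ?(ltW x0) ?(ltW t1).
  + by rewrite ler_expR lerN2.
Qed.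

(** The dependence on the rate comes from the substitution [x := y x]. *)
Lemma gamma_integral (t : R) : 0 < t -> exists2 C : R, 0 < C & forall y : R, 0 < y ->
  (\int[mu]_x (gamma_fun t y x)%:E = (C * y `^ (- t))%:E)%E.
Proof.
move=> t0; have I0 := gamma_integral_gt0 t0; have Ioo := gamma_integral_fin t0.
have Ifin : (\int[mu]_x (gamma_fun t 1 x)%:E)%E \is a fin_num.
  by rewrite ge0_fin_numE// ltW.
exists (fine (\int[mu]_x (gamma_fun t 1 x)%:E)); first by rewrite fine_gt0// I0.
move=> y y0; rewrite EFinM fineK//.
rewrite [in RHS](@integral_affine _ y 0)//; last 2 first.
- apply/measurable_EFinP; exact: measurable_gamma_fun.
- by move=> x; rewrite lee_fin gamma_fun_ge0.
rewrite -[in RHS]ge0_integralZl//=; last 3 first.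
- apply/measurable_EFinP; apply: measurableT_comp; first exact: measurable_gamma_fun.
  by apply: measurable_funD => //; exact: measurable_funM.
- by move=> x _; rewrite lee_fin gamma_fun_ge0.
- by rewrite lee_fin ltW.
rewrite muleC -ge0_integralZl//=; last 3 first.
- apply: emeasurable_funM => //; apply/measurable_EFinP.
  apply: measurableT_comp; first exact: measurable_gamma_fun.
  by apply: measurable_funD => //; exact: measurable_funM.
- by move=> x _; rewrite -EFinM lee_fin mulr_ge0 ?gamma_fun_ge0// ltW.
- by rewrite lee_fin powR_ge0.
apply: eq_integral => x _; rewrite -!EFinM; congr EFin.
rewrite /gamma_fun addr0 mul1r pmulr_rgt0//; case: ifPn => x0; last by rewrite !mulr0.
rewrite powRM ?ltW// !mulrA; congr (_ * _); rewrite -[LHS]mul1r; congr (_ * _).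
rewrite -mulrA mulr_powRB1 ?ltW// -powRD; last by rewrite (gt_eqF y0) implybT.
by rewrite addNr powRr0.
Qed.

Lemma gauss_integral (q z : R) : 0 < q ->
  (\int[mu]_x (expR (- (q * x ^+ 2) - 2 * z * x))%:E =
   (Num.sqrt (pi / q) * expR (z ^+ 2 / q))%:E)%E.
Proof.
move=> q0.
pose sg := Num.sqrt ((2 * q)^-1).
have sg0 : sg != 0 by rewrite gt_eqF// sqrtr_gt0 invr_gt0 mulr_gt0.
have sg2 : sg ^+ 2 = (2 * q)^-1.
  by rewrite sqr_sqrtr// invr_ge0 mulr_ge0// ltW.
have pk : normal_peak sg = (Num.sqrt (pi / q))^-1.
  rewrite /normal_peak sg2; congr ((Num.sqrt _)^-1).
  by rewrite -mulr_natr; field; rewrite gt_eqF.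
have sq0 : 0 < Num.sqrt (pi / q) by rewrite sqrtr_gt0 divr_gt0// pi_gt0.
transitivity (\int[mu]_x ((Num.sqrt (pi / q) * expR (z ^+ 2 / q))%:E *
     (normal_pdf (- (z / q)) sg x)%:E))%E.
  apply: eq_integral => x _; rewrite -EFinM normal_pdfE// pk; congr EFin.
  rewrite /normal_fun sg2 mulrACA divff ?gt_eqF// mul1r -expRD; congr expR.
  by rewrite -mulr_natr; field; rewrite gt_eqF.
rewrite ge0_integralZl//=; last 2 first.
- apply/measurable_EFinP; exact: measurable_normal_pdf.
- by move=> x _; rewrite lee_fin normal_pdf_ge0.
by rewrite integral_normal_pdf mule1.
Qed.

(** The factor of the density for the edge joining a vertex with diagonal entry [a]
    to its parent with diagonal entry [c]; [b] is the entry of the edge. *)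
Definition edge_kernel (s a b c : R) : R :=
  if [&& 0 < a, 0 < c & b ^+ 2 < a * c] then
    (a * c - b ^+ 2) `^ (s - 3 / 2) * c `^ (1 - s) else 0.

Lemma edge_kernel_ge0 s a b c : 0 <= edge_kernel s a b c.
Proof. by rewrite /edge_kernel; case: ifP => // _; rewrite mulr_ge0 ?powR_ge0. Qed.

Lemma measurable_edge_kernel s d (T : measurableType d) (f g h : T -> R) :
  measurable_fun setT f -> measurable_fun setT g -> measurable_fun setT h ->
  measurable_fun setT (fun x => edge_kernel s (f x) (g x) (h x)).
Proof.
move=> mf mg mh; apply: measurable_fun_ifT => //.
  apply: measurable_and; first exact: measurable_fun_ltr.
  apply: measurable_and; first exact: measurable_fun_ltr.
  apply: measurable_fun_ltr; first exact: measurable_funX.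
  exact: measurable_funM.
apply: measurable_funM.
  apply: (measurableT_comp (measurable_powR _)).
  apply: measurable_funB; first exact: measurable_funM.
  exact: measurable_funX.
exact: (measurableT_comp (measurable_powR _)).
Qed.

(** For fixed [b], the translation [a := a + b^2 / c] turns the inner integral into a
    gamma integral; completing the square in [b] leaves a Gaussian integral.  The
    exponent [1 - s] of [c] in the kernel is the one that makes every power of [c]
    disappear from the result. *)
Lemma edge_integral (s : R) : 1 / 2 < s -> exists2 C : R, 0 < C & forall y z c : R, 0 < y -> 0 < c ->
  (\int[mu]_b \int[mu]_a (expR (- (y * a) - 2 * z * b) * edge_kernel s a b c)%:E =
   (C * y `^ (- s) * expR (c * (z ^+ 2 / y)))%:E)%E.
Proof.
move=> s12; have t0 : 0 < s - 1 / 2 by rewrite subr_gt0.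
have [C C0 HC] := gamma_integral t0.
exists (C * Num.sqrt pi); first by rewrite mulr_gt0 ?sqrtr_gt0 ?pi_gt0.
move=> y z c y0 c0.
have inner b : (\int[mu]_a (expR (- (y * a) - 2 * z * b) * edge_kernel s a b c)%:E =
   (expR (- (y / c * b ^+ 2) - 2 * z * b) * (c `^ (- (1 / 2)) * (C * y `^ (- (s - 1 / 2)))))%:E)%E.
  rewrite (@integral_affine _ 1 (b ^+ 2 / c))//; last 2 first.
  - apply/measurable_EFinP; apply: measurable_funM; last exact: measurable_edge_kernel.
    apply: measurableT_comp => //; apply: measurable_funB => //.
    apply: measurableT_comp => //; exact: measurable_funM.
  - by move=> x; rewrite lee_fin mulr_ge0 ?expR_ge0 ?edge_kernel_ge0.
  rewrite mul1e mulrA EFinM -HC// -ge0_integralZl//=; last 3 first.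
  - apply/measurable_EFinP; exact: measurable_gamma_fun.
  - by move=> x _; rewrite lee_fin gamma_fun_ge0.
  - by rewrite lee_fin mulr_ge0 ?expR_ge0 ?powR_ge0.
  apply: eq_integral => a _; rewrite -EFinM; congr EFin.
  rewrite mul1r; set A := a + b ^+ 2 / c.
  have Ac : A * c = a * c + b ^+ 2 by rewrite mulrDl divfK// gt_eqF.
  rewrite /edge_kernel /gamma_fun c0 Ac addrK ltrDr pmulr_lgt0//=.
  case: (ltP 0 a) => a0; last by rewrite andbF !mulr0.
  rewrite andbT [X in if X then _ else _](_ : _ = true); last first.
    by rewrite ltr_wpDr// divr_ge0 ?sqr_ge0// ltW.
  rewrite powRM ?ltW//.
  transitivity (expR (- (y * A) - 2 * z * b) * (a `^ (s - 3 / 2) *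
     (c `^ (s - 3 / 2) * c `^ (1 - s)))); first by rewrite !mulrA.
  rewrite -powRD; last by rewrite (gt_eqF c0) implybT.
  rewrite (_ : s - 3 / 2 + (1 - s) = - (1 / 2)); last by field.
  rewrite (_ : s - 3 / 2 = s - 1 / 2 - 1); last by field.
  rewrite (_ : expR (- (y * A) - 2 * z * b) =
     expR (- (y / c * b ^+ 2) - 2 * z * b) * expR (- (y * a))); first by ring.
  by rewrite -expRD /A; congr expR; field; rewrite gt_eqF.
under eq_integral do rewrite inner EFinM.
rewrite ge0_integralZr//=; last 2 first.
- apply/measurable_EFinP; apply: measurableT_comp => //; apply: measurable_funB => //.
  by apply: measurableT_comp => //; apply: measurable_funM => //; exact: measurable_funX.
- by rewrite lee_fin !mulr_ge0 ?powR_ge0// ltW.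
rewrite gauss_integral ?divr_gt0// -EFinM; congr EFin.
have yV r : y^-1 `^ r = y `^ (- r) by rewrite -(powR_inv1 (ltW y0)) -powRrM mulN1r.
have -> : Num.sqrt (pi / (y / c)) = Num.sqrt pi * (c `^ (1 / 2) * y `^ (- (1 / 2))).
  rewrite -!powR12_sqrt ?divr_ge0 ?pi_ge0 ?ltW ?divr_gt0//.
  rewrite invf_div powRM ?pi_ge0 ?divr_ge0 ?(ltW c0) ?(ltW y0)//.
  by rewrite powRM ?invr_ge0 ?(ltW c0) ?(ltW y0)// yV div1r.
have -> : y `^ (- s) = y `^ (- (1 / 2)) * y `^ (- (s - 1 / 2)).
  by rewrite -powRD; [congr (_ `^ _); field|rewrite (gt_eqF y0) implybT].
have -> : z ^+ 2 / (y / c) = c * (z ^+ 2 / y) by field; rewrite !gt_eqF.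
have cc : c `^ (1 / 2) * c `^ (- (1 / 2)) = 1.
  by rewrite -powRD ?subrr ?powRr0// (gt_eqF c0) implybT.
by rewrite -[RHS]mul1r -[X in _ = X * _]cc; ring.
Qed.
End LineIntegrals.

(** * Iterated integrals over tuples *)

Section TupleIntegral.
Context {R : realType}.
Local Notation mu := (@lebesgue_measure R).
Local Notation TR n := (n.-tuple (measurableTypeR R)).
Local Notation leb n := (@lebesgue_tuple R n).
Local Open Scope ereal_scope.

Lemma integral_tuple0 (f : TR 0 -> \bar R) : measurable_fun setT f ->
  \int[leb 0]_x f x = f [tuple].
Proof. by move=> mf; rewrite integral_dirac// diracT mul1e. Qed.

Lemma integral_tuple_cons n (f : TR n.+1 -> \bar R) : measurable_fun setT f ->
  (forall x, 0 <= f x) ->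
  \int[leb n.+1]_x f x = \int[mu]_a \int[leb n]_t f [tuple of a :: t].
Proof.
move=> mf f0.
have mc : measurable_fun [set: measurableTypeR R * TR n]
    (fun p => [tuple of p.1 :: p.2]) by exact: measurable_cons.
transitivity (\int[pushforward (mu \x leb n) (fun p => [tuple of p.1 :: p.2])]_x f x).
  by [].
rewrite ge0_integral_pushforward//= fubini_tonelli1//=.
by apply: measurableT_comp => //.
Qed.

Variables (d : measure_display) (A : measurableType d).

Lemma measurable_param_integral d' (B : measurableType d')
  (m : {sigma_finite_measure set B -> \bar R}) (f : A -> B -> \bar R) :
  measurable_fun setT (fun p : A * B => f p.1 p.2) -> (forall a b, 0 <= f a b) ->
  measurable_fun setT (fun a => \int[m]_b f a b).
Proof.
by move=> mf f0; exact: (measurable_fun_fubini_tonelli_F (fun p => f p.1 p.2)).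
Qed.

(** Integral over [R^n * R^n], the first tuple holding diagonal entries and the
    second one the entries of the edges towards the parents. *)
Definition integral2 n (f : TR n -> TR n -> \bar R) := \int[leb n]_x \int[leb n]_u f x u.

Lemma integral2_ge0 n f : (forall x u, 0 <= f x u) -> 0 <= @integral2 n f.
Proof. by move=> f0; apply: integral_ge0 => x _; apply: integral_ge0. Qed.

Lemma measurable_integral2 n (f : A -> TR n -> TR n -> \bar R) :
  measurable_fun setT (fun p : A * (TR n * TR n) => f p.1 p.2.1 p.2.2) ->
  (forall a x u, 0 <= f a x u) ->
  measurable_fun setT (fun a => integral2 (f a)).
Proof.
move=> mf f0; apply: measurable_param_integral; last first.
  by move=> a x; exact: integral_ge0.
apply: (@measurable_fun_fubini_tonelli_F _ _ _ _ _ _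
   (fun p : (A * TR n) * TR n => f p.1.1 p.1.2 p.2)) => //.
apply: (measurableT_comp mf (g := fun p : (A * TR n) * TR n => (p.1.1, (p.1.2, p.2)))).
apply: measurable_fun_pair; first exact: (measurableT_comp measurable_fst).
by apply: measurable_fun_pair => //; exact: (measurableT_comp measurable_snd).
Qed.

End TupleIntegral.

Section TupleFubini.
Context {R : realType}.
Local Notation mu := (@lebesgue_measure R).
Local Notation TR n := (n.-tuple (measurableTypeR R)).
Local Notation leb n := (@lebesgue_tuple R n).
Local Open Scope ereal_scope.
Implicit Types n : nat.

(** Tonelli's theorem moves the two heads outwards, so that one vertex of a path can
    be integrated out at a time. *)
Lemma integral2_cons n (f : TR n.+1 -> TR n.+1 -> \bar R) :
  measurable_fun setT (fun p : TR n.+1 * TR n.+1 => f p.1 p.2) ->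
  (forall x u, 0 <= f x u) ->
  integral2 f = \int[mu]_b \int[mu]_a
    integral2 (fun x u => f [tuple of a :: x] [tuple of b :: u]).
Proof.
move=> mf f0.
have mfx x : measurable_fun setT (f x).
  by apply: (measurableT_comp mf (g := fun u => (x, u))); exact: measurable_fun_pair.
rewrite /integral2 integral_tuple_cons; last 2 first.
- exact: (measurable_param_integral (B := TR n.+1)).
- by move=> x; exact: integral_ge0.
under eq_integral do under eq_integral do rewrite integral_tuple_cons//.
have m4 : measurable_fun setT
   (fun q : (((measurableTypeR R) * TR n) * measurableTypeR R) * TR n =>
      f [tuple of q.1.1.1 :: q.1.1.2] [tuple of q.1.2 :: q.2]).
  apply: (measurableT_comp mf (g := fun q : (((measurableTypeR R) * TR n) *
     measurableTypeR R) * TR n => ([tuple of q.1.1.1 :: q.1.1.2], [tuple of q.1.2 :: q.2]))).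
  have m1 : measurable_fun setT (fun q : (((measurableTypeR R) * TR n) *
     measurableTypeR R) * TR n => q.1) by exact: measurable_fst.
  have m11 := measurableT_comp measurable_fst m1.
  apply: measurable_fun_pair; apply: measurable_cons.
  - exact: (measurableT_comp measurable_fst m11).
  - exact: (measurableT_comp measurable_snd m11).
  - exact: (measurableT_comp measurable_snd m1).
  - exact: measurable_snd.
have m3 := measurable_fun_fubini_tonelli_F (m2 := leb n) _ m4 (fun=> f0 _ _).
rewrite /fubini_F /= in m3.
transitivity (\int[mu]_a \int[mu]_b \int[leb n]_t \int[leb n]_u
    f [tuple of a :: t] [tuple of b :: u]).
  apply: eq_integral => a _.
  apply: (fubini_tonelli (fun p : TR n * measurableTypeR R => \int[leb n]_u
    f [tuple of a :: p.1] [tuple of p.2 :: u])) => //=.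
    apply: (measurableT_comp m3 (g := fun p : TR n * measurableTypeR R => ((a, p.1), p.2))).
    apply: measurable_fun_pair; last exact: measurable_snd.
    by apply: measurable_fun_pair; last exact: measurable_fst.
  by move=> p; exact: integral_ge0.
apply: (fubini_tonelli (fun p : measurableTypeR R * measurableTypeR R => \int[leb n]_t
    \int[leb n]_u f [tuple of p.1 :: t] [tuple of p.2 :: u])) => //=; last first.
  by move=> p; apply: integral_ge0 => t _; exact: integral_ge0.
apply: (@measurable_fun_fubini_tonelli_F _ _ _ _ _ _
   (fun p : (measurableTypeR R * measurableTypeR R) * TR n =>
   \int[leb n]_u f [tuple of p.1.1 :: p.2] [tuple of p.1.2 :: u])); last first.
  by move=> p; exact: integral_ge0.
apply: (measurableT_comp m3 (g := fun p : (measurableTypeR R * measurableTypeR R) * TR n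
   => ((p.1.1, p.2), p.1.2))).
apply: measurable_fun_pair; last exact: (measurableT_comp measurable_snd measurable_fst).
apply: measurable_fun_pair; last exact: measurable_snd.
exact: (measurableT_comp measurable_fst measurable_fst).
Qed.

Lemma integral2_nil (f : TR 0 -> TR 0 -> \bar R) :
  measurable_fun setT (fun p : TR 0 * TR 0 => f p.1 p.2) ->
  (forall x u, 0 <= f x u) ->
  integral2 f = f [tuple] [tuple].
Proof.
move=> mf f0; rewrite /integral2 integral_tuple0; last first.
  exact: (measurable_param_integral (B := TR 0)).
rewrite integral_tuple0//.
by apply: (measurableT_comp mf (g := fun u => ([tuple], u))); exact: measurable_fun_pair.
Qed.

Lemma integral2Zl n (k : R) (f : TR n -> TR n -> \bar R) : (0 <= k)%R ->
  measurable_fun setT (fun p : TR n * TR n => f p.1 p.2) ->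
  (forall x u, 0 <= f x u) ->
  integral2 (fun x u => k%:E * f x u) = k%:E * integral2 f.
Proof.
move=> k0 mf f0; rewrite /integral2.
transitivity (\int[leb n]_x (k%:E * \int[leb n]_u f x u)).
  apply: eq_integral => x _; rewrite ge0_integralZl//.
  by apply: (measurableT_comp mf (g := fun u => (x, u))); exact: measurable_fun_pair.
rewrite ge0_integralZl//.
  exact: (measurable_param_integral (B := TR n)).
by move=> x _; exact: integral_ge0.
Qed.

Lemma integral_IG n (f : TR n.+1 -> TR n -> \bar R) :
  measurable_fun setT (fun p : TR n.+1 * TR n => f p.1 p.2) ->
  (forall x u, 0 <= f x u) ->
  \int[@leb_IG R n.+1]_e f e.1 e.2 =
  \int[mu]_a integral2 (fun x u => f [tuple of a :: x] u).
Proof.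
move=> mf f0; rewrite /leb_IG (fubini_tonelli1 (fun p : TR n.+1 * TR n => f p.1 p.2))//=.
rewrite /fubini_F /= integral_tuple_cons//.
  exact: (measurable_param_integral (B := TR n)).
by move=> x; exact: integral_ge0.
Qed.

Lemma fubini_swap3 (g : R -> R -> R -> \bar R) :
  measurable_fun setT (fun p : (measurableTypeR R * measurableTypeR R) * measurableTypeR R =>
    g p.1.1 p.1.2 p.2) ->
  (forall a b c, 0 <= g a b c) ->
  \int[mu]_a \int[mu]_b \int[mu]_c g a b c = \int[mu]_c \int[mu]_b \int[mu]_a g a b c.
Proof.
move=> mg g0.
have mp (h1 h2 h3 : measurableTypeR R * measurableTypeR R * measurableTypeR R ->
    measurableTypeR R) : measurable_fun setT h1 -> measurable_fun setT h2 ->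
    measurable_fun setT h3 -> measurable_fun setT (fun p => g (h1 p) (h2 p) (h3 p)).
  move=> m1 m2 m3; apply: (measurableT_comp mg (g := fun p => ((h1 p, h2 p), h3 p))).
  by apply: measurable_fun_pair => //; exact: measurable_fun_pair.
have m1 : measurable_fun setT (fun p : measurableTypeR R * measurableTypeR R *
   measurableTypeR R => p.1.1) by exact: (measurableT_comp measurable_fst measurable_fst).
have m2 : measurable_fun setT (fun p : measurableTypeR R * measurableTypeR R *
   measurableTypeR R => p.1.2) by exact: (measurableT_comp measurable_snd measurable_fst).
have m3 : measurable_fun setT (fun p : measurableTypeR R * measurableTypeR R *
   measurableTypeR R => p.2) by exact: measurable_snd.
transitivity (\int[mu]_a \int[mu]_c \int[mu]_b g a b c).
  apply: eq_integral => a _.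
  apply: (fubini_tonelli (fun p : measurableTypeR R * measurableTypeR R => g a p.1 p.2)) => //.
  apply: (measurableT_comp mg (g := fun p : measurableTypeR R * measurableTypeR R
    => ((a, p.1), p.2))).
  apply: measurable_fun_pair; last exact: measurable_snd.
  by apply: measurable_fun_pair; last exact: measurable_fst.
transitivity (\int[mu]_c \int[mu]_a \int[mu]_b g a b c).
  apply: (fubini_tonelli (fun p : measurableTypeR R * measurableTypeR R =>
     \int[mu]_b g p.1 b p.2)) => //; last by move=> p; exact: integral_ge0.
  apply: (@measurable_fun_fubini_tonelli_F _ _ _ _ _ _
    (fun p : (measurableTypeR R * measurableTypeR R) * measurableTypeR R =>
     g p.1.1 p.2 p.1.2)) => //; exact: mp.
apply: eq_integral => c _.
apply: (fubini_tonelli (fun p : measurableTypeR R * measurableTypeR R => g p.1 p.2 c)) => //.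
apply: (measurableT_comp mg (g := fun p : measurableTypeR R * measurableTypeR R
    => ((p.1, p.2), c))).
apply: measurable_fun_pair => //.
by apply: measurable_fun_pair; [exact: measurable_fst|exact: measurable_snd].
Qed.

End TupleFubini.

(** * The Laplace transform along the path *)

Section PathIntegral.
Context {R : realType}.
Local Notation mu := (@lebesgue_measure R).
Local Notation MR := (measurableTypeR R).
Local Notation TR n := (n.-tuple (measurableTypeR R)).
Local Notation leb n := (@lebesgue_tuple R n).
Implicit Types (s y z : nat -> R).

(** The continued fraction that elimination of the [k] vertices following the vertex
    [i] subtracts from [y_i]. *)
Fixpoint right_corr y z k i : R :=
  if k is k'.+1 then z i ^+ 2 / (y i.+1 - right_corr y z k' i.+1) else 0.

(** The continued fraction that elimination of the [i] vertices preceding the vertex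
    [i] subtracts from [y_i]. *)
Fixpoint left_corr y z i : R :=
  if i is i'.+1 then z i' ^+ 2 / (y i' - left_corr y z i') else 0.

Fixpoint right_log_pivots s y z k i : R :=
  if k is k'.+1 then s i.+1 * ln (y i.+1 - right_corr y z k' i.+1) + right_log_pivots s y z k' i.+1 else 0.

Fixpoint right_pivots_gt0 y z k i : bool :=
  if k is k'.+1 then (0 < y i.+1 - right_corr y z k' i.+1) && right_pivots_gt0 y z k' i.+1 else true.

(** The edge is [(i, i+1)] with parent [i+1]; the exponential carries the part of the
    pairing that belongs to the leaf and to the edge. *)
Definition left_weight s y z i (a b c : R) :=
  expR (- (y i * a) - 2 * z i * b) * edge_kernel (s i) a b c.

Definition right_weight s y z i (c b a : R) :=
  expR (- (y i.+1 * a) - 2 * z i * b) * edge_kernel (s i.+1) a b c.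

(** The [k] vertices following the vertex [i], whose diagonal entry is [c]; the parent
    of the [j]-th of them has the entry of index [j] in [c :: x]. *)
Definition right_chain s y z k i (c : R) (x u : seq R) :=
  \prod_(j < k) right_weight s y z (i + j) (nth 0 (c :: x) j) (nth 0 u j) (nth 0 x j).

(** The path starts at the vertex [i] and has its root at [i + d], with [k] vertices
    after it.  Keeping the absolute index [i] lets the first vertex be removed without
    shifting the parameters. *)
Definition path_density s y z d k i (x u : seq R) :=
  \prod_(j < d) left_weight s y z (i + j) (nth 0 x j) (nth 0 u j) (nth 0 x j.+1) *
  gamma_fun (s (i + d)%N) (y (i + d)%N) (nth 0 x d) *
  \prod_(j < k) right_weight s y z (i + d + j) (nth 0 x (d + j)) (nth 0 u (d + j))
                  (nth 0 x (d + j).+1).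

Section WeightMeasurability.
Context d (T : measurableType d).

Lemma measurable_nth n (x : T -> TR n) j : measurable_fun setT x ->
  measurable_fun setT (fun t => nth 0 (x t) j : R).
Proof.
move=> mx; case: (ltnP j n) => jn; last first.
  rewrite (_ : (fun t => _) = cst 0)//; apply/funext => t /=.
  by rewrite nth_default// size_tuple.
rewrite (_ : (fun t => _) = (@tnth n MR ^~ (Ordinal jn)) \o x).
  apply: measurableT_comp => //; exact: measurable_tnth.
by apply/funext => t /=; rewrite (tnth_nth 0).
Qed.

Lemma measurable_prod_ord k (F : nat -> T -> R) :
  (forall j, measurable_fun setT (F j)) ->
  measurable_fun setT (fun t => \prod_(j < k) F j t).
Proof.
move=> mF; elim: k => [|k IH].
  rewrite (_ : (fun t => _) = cst 1)//; by apply/funext => t; rewrite big_ord0.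
rewrite (_ : (fun t => _) = (fun t => (\prod_(j < k) F j t) * F k t)).
  exact: measurable_funM.
by apply/funext => t; rewrite big_ord_recr.
Qed.

Lemma measurable_edge_weight (p q r : R) (f g h : T -> R) :
  measurable_fun setT f -> measurable_fun setT g -> measurable_fun setT h ->
  measurable_fun setT (fun t => expR (- (p * f t) - 2 * q * g t) * edge_kernel r (f t) (g t) (h t)).
Proof.
move=> mf mg mh; apply: measurable_funM; last exact: measurable_edge_kernel.
apply: measurableT_comp => //; apply: measurable_funB.
  by apply: measurableT_comp => //; exact: measurable_funM.
exact: measurable_funM.
Qed.

Lemma measurable_right_chain s y z k i n n' (c : T -> R) (x : T -> TR n) (u : T -> TR n') :
  measurable_fun setT c -> measurable_fun setT x -> measurable_fun setT u ->
  measurable_fun setT (fun t => right_chain s y z k i (c t) (x t) (u t)).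
Proof.
move=> mc mx mu; apply: (@measurable_prod_ord _ (fun j t =>
  right_weight s y z (i + j) (nth 0 (c t :: x t) j) (nth 0 (u t) j) (nth 0 (x t) j))) => j.
apply: measurable_edge_weight; try exact: measurable_nth.
by case: j => [|j] /=; [exact: mc|exact: measurable_nth].
Qed.

Lemma measurable_path_density s y z e k i n n' (x : T -> TR n) (u : T -> TR n') :
  measurable_fun setT x -> measurable_fun setT u ->
  measurable_fun setT (fun t => path_density s y z e k i (x t) (u t)).
Proof.
move=> mx mu; apply: measurable_funM; first apply: measurable_funM.
- apply: (@measurable_prod_ord _ (fun j t =>
    left_weight s y z (i + j) (nth 0 (x t) j) (nth 0 (u t) j) (nth 0 (x t) j.+1))) => j.
  by apply: measurable_edge_weight; exact: measurable_nth.
- apply: (measurableT_comp (measurable_gamma_fun _ _)); exact: measurable_nth.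
- apply: (@measurable_prod_ord _ (fun j t =>
    right_weight s y z (i + e + j) (nth 0 (x t) (e + j)) (nth 0 (u t) (e + j)) (nth 0 (x t) (e + j).+1))) => j.
  by apply: measurable_edge_weight; exact: measurable_nth.
Qed.
End WeightMeasurability.

Lemma right_weight_ge0 s y z i c b a : 0 <= right_weight s y z i c b a.
Proof. by rewrite mulr_ge0 ?expR_ge0 ?edge_kernel_ge0. Qed.

Lemma left_weight_ge0 s y z i c b a : 0 <= left_weight s y z i c b a.
Proof. by rewrite mulr_ge0 ?expR_ge0 ?edge_kernel_ge0. Qed.

Lemma right_chain_ge0 s y z k i c x u : 0 <= right_chain s y z k i c x u.
Proof. by apply: prodr_ge0 => j _; exact: right_weight_ge0. Qed.

Lemma path_density_ge0 s y z e k i x u : 0 <= path_density s y z e k i x u.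
Proof.
rewrite !mulr_ge0 ?gamma_fun_ge0//; apply: prodr_ge0 => j _.
  exact: left_weight_ge0.
exact: right_weight_ge0.
Qed.

Lemma right_chain_cons s y z k i c a b x u :
  right_chain s y z k.+1 i c (a :: x) (b :: u) =
  right_weight s y z i c b a * right_chain s y z k i.+1 a x u.
Proof.
rewrite /right_chain big_ord_recl /= addn0; congr (_ * _).
by apply: eq_bigr => j _; rewrite /= addSnnS.
Qed.

Lemma path_density_cons s y z d k i a b x u :
  path_density s y z d.+1 k i (a :: x) (b :: u) =
  left_weight s y z i a b (nth 0 x 0) * path_density s y z d k i.+1 x u.
Proof.
rewrite /path_density big_ord_recl /= addn0.
rewrite (eq_bigr (fun j : 'I_d => left_weight s y z (i.+1 + j) x`_j u`_j x`_j.+1)); last first.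
  by move=> j _; rewrite /= addSnnS.
by rewrite addSnnS !mulrA.
Qed.

Lemma path_density_root s y z k i a x u :
  path_density s y z 0 k i (a :: x) u = gamma_fun (s i) (y i) a * right_chain s y z k i a x u.
Proof. by rewrite /path_density big_ord0 mul1r addn0. Qed.

Lemma edge_kernel_leaf_le0 (r a b c : R) : a <= 0 -> edge_kernel r a b c = 0.
Proof. by rewrite /edge_kernel ltNge => ->. Qed.

Lemma path_density_head_le0 s y z d k i a x u : a <= 0 -> path_density s y z d k i (a :: x) u = 0.
Proof.
move=> a0; case: d => [|d]; first by rewrite path_density_root /gamma_fun ltNge a0 mul0r.
by rewrite /path_density big_ord_recl /left_weight /= edge_kernel_leaf_le0// mulr0 !mul0r.
Qed.

Local Open Scope ereal_scope.

Lemma edge_integralZ (r C : R) (Q : \bar R) (y z c : R) : (0 < C)%R -> 0 <= Q ->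
  \int[mu]_b \int[mu]_a (expR (- (y * a) - 2 * z * b) * edge_kernel r a b c)%:E = C%:E ->
  \int[mu]_b \int[mu]_a (Q * (expR (- (y * a) - 2 * z * b) * edge_kernel r a b c)%:E) = Q * C%:E.
Proof.
move=> C0 Q0 HC; rewrite -HC.
have mk (b : MR) : measurable_fun setT (fun a : MR =>
    (expR (- (y * a) - 2 * z * b) * edge_kernel r a b c)%:E).
  by apply/measurable_EFinP; apply: (@measurable_edge_weight _ MR y z r (fun a => a)).
have k0 (a b : R) : 0 <= (expR (- (y * a) - 2 * z * b) * edge_kernel r a b c)%:E.
  by rewrite lee_fin mulr_ge0 ?expR_ge0 ?edge_kernel_ge0.
transitivity (\int[mu]_b (Q * \int[mu]_a (expR (- (y * a) - 2 * z * b) * edge_kernel r a b c)%:E)).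
  by apply: eq_integral => b _; rewrite ge0_integralZl.
rewrite ge0_integralZl//.
- apply: (measurable_fun_fubini_tonelli_F (fun p : MR * MR =>
     (expR (- (y * p.2) - 2 * z * p.1) * edge_kernel r p.2 p.1 c)%:E)) => //.
  apply/measurable_EFinP; apply: (@measurable_edge_weight _ (MR * MR)%type y z r snd fst).
  - exact: measurable_snd.
  - exact: measurable_fst.
  - by [].
- by move=> b _; exact: integral_ge0.
Qed.

(** Eliminating the last vertices first leaves, for each vertex, an edge integral in
    which [y_i] is replaced by its pivot. *)
Lemma right_chain_integral s k i : (forall j, (i < j <= i + k)%N -> 1 / 2 < s j)%R ->
  exists2 K : R, (0 < K)%R & forall y z, right_pivots_gt0 y z k i -> forall c, (0 < c)%R ->
   integral2 (fun x u : TR k => (right_chain s y z k i c x u)%:E) =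
   (K * expR (- right_log_pivots s y z k i) * expR (c * right_corr y z k i))%:E.
Proof.
elim: k i => [|k IH] i hs.
  exists 1%R => // y z _ c c0.
  rewrite integral2_nil; last 2 first.
  - by apply/measurable_EFinP; apply: measurable_right_chain.
  - by move=> x u; rewrite lee_fin right_chain_ge0.
  by rewrite /right_chain big_ord0 /= oppr0 mulr0 expR0 !mulr1.
have [j /andP[ij jk]|K K0 HK] := IH i.+1.
  by apply: hs; rewrite (ltnW ij)/= -addSnnS.
have /edge_integral[C C0 HC] : (1 / 2 < s i.+1)%R.
  by apply: hs; rewrite ltnSn/= -addSnnS leq_addr.
exists (C * K)%R; first exact: mulr_gt0.
move=> y z /= /andP[pi pos] c c0.
set E := right_corr y z k i.+1; set p := (y i.+1 - E)%R.
rewrite integral2_cons; last 2 first.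
- by apply/measurable_EFinP; apply: measurable_right_chain.
- by move=> x u; rewrite lee_fin right_chain_ge0.
transitivity (\int[mu]_b \int[mu]_a ((K * expR (- right_log_pivots s y z k i.+1))%:E *
    (expR (- (p * a) - 2 * z i * b) * edge_kernel (s i.+1) a b c)%:E)).
  apply: eq_integral => b _; apply: eq_integral => a _.
  transitivity (integral2 (fun x u : TR k => (right_weight s y z i c b a)%:E *
     (right_chain s y z k i.+1 a x u)%:E)).
    by apply: eq_integral => x _; apply: eq_integral => u _; rewrite right_chain_cons EFinM.
  rewrite integral2Zl ?right_weight_ge0//; last 2 first.
  - by apply/measurable_EFinP; apply: measurable_right_chain.
  - by move=> x u; rewrite lee_fin right_chain_ge0.
  case: (ltP 0%R a) => a0; last by rewrite /right_weight !edge_kernel_leaf_le0// !mulr0 mul0e mule0.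
  rewrite HK// -!EFinM /right_weight -/E; congr EFin.
  rewrite (_ : - (p * a) - 2 * z i * b = (- (y i.+1 * a) - 2 * z i * b) + a * E)%R; last first.
    by rewrite /p; ring.
  by rewrite [in RHS]expRD; ring.
rewrite (edge_integralZ _ _ (HC p (z i) c pi c0)).
- rewrite -EFinM /powR gt_eqF//; congr EFin.
  by rewrite opprD expRD mulNr; ring.
- by rewrite !mulr_gt0 ?powR_gt0 ?expR_gt0.
- by rewrite lee_fin mulr_ge0 ?expR_ge0// ltW.
Qed.

(** The factor [exp (left_corr i * a)] is what the already eliminated vertices have
    left on the vertex [i]; it turns [y_i] into its pivot, and eliminating [i]
    produces the factor of [i + 1]. *)
Lemma path_density_integral s k d i : (forall j, (i <= j <= i + d + k)%N -> j <> (i + d)%N -> 1 / 2 < s j)%R ->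
  (0 < s (i + d)%N)%R ->
  exists2 K : R, (0 < K)%R & forall y z,
   (forall j, (i <= j < i + d)%N -> 0 < y j - left_corr y z j)%R ->
   (0 < y (i + d)%N - left_corr y z (i + d) - right_corr y z k (i + d))%R ->
   right_pivots_gt0 y z k (i + d) ->
   \int[mu]_a integral2 (fun x u : TR (d + k) =>
       (expR (left_corr y z i * a) * path_density s y z d k i (a :: x) u)%:E) =
   (K * expR (- (\sum_(i <= j < i + d) s j * ln (y j - left_corr y z j) +
      s (i + d)%N * ln (y (i + d)%N - left_corr y z (i + d) - right_corr y z k (i + d)) +
      right_log_pivots s y z k (i + d))))%:E.
Proof.
elim: d i => [|d IH] i hs sm0.
  rewrite !addn0 in hs sm0 *.
  have [j /andP[ij jk]|K K0 HK] := @right_chain_integral s k i.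
    by apply: hs; rewrite ?(ltnW ij)// => ji; rewrite ji ltnn in ij.
  have [C C0 HC] := gamma_integral sm0.
  exists (K * C)%R; first exact: mulr_gt0.
  move=> y z _; set E := left_corr y z i; set E' := right_corr y z k i => p0 pos.
  rewrite add0n.
  transitivity (\int[mu]_a ((K * expR (- right_log_pivots s y z k i))%:E * (gamma_fun (s i) (y i - E - E') a)%:E)).
    apply: eq_integral => a _.
    transitivity (integral2 (fun x u : TR k => (expR (E * a) * gamma_fun (s i) (y i) a)%:E *
       (right_chain s y z k i a x u)%:E)).
      by apply: eq_integral => x _; apply: eq_integral => u _; rewrite path_density_root -EFinM mulrA.
    rewrite integral2Zl ?mulr_ge0 ?expR_ge0 ?gamma_fun_ge0//; last 2 first.
    - by apply/measurable_EFinP; apply: measurable_right_chain.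
    - by move=> x u; rewrite lee_fin right_chain_ge0.
    case: (ltP 0%R a) => a0; last by rewrite /gamma_fun ltNge a0/= !mulr0 mul0e mule0.
    rewrite HK// -!EFinM; congr EFin; rewrite /gamma_fun a0 -/E'.
    rewrite (_ : - ((y i - E - E') * a) = E * a + a * E' - y i * a)%R; last by ring.
    by rewrite 2!expRD; ring.
  rewrite ge0_integralZl//; last 3 first.
  - by apply/measurable_EFinP; exact: measurable_gamma_fun.
  - by move=> a _; rewrite lee_fin gamma_fun_ge0.
  - by rewrite lee_fin mulr_ge0 ?expR_ge0// ltW.
  rewrite HC// -EFinM; congr EFin.
  by rewrite /powR gt_eqF// big_geq// add0r opprD expRD mulNr; ring.
rewrite !addnS -!addSn in hs sm0 *.
have [j /andP[ij jk]|//|K K0 HK] := IH i.+1.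
  by apply: hs; rewrite (ltnW ij)/= (leq_trans jk)// !addSn.
have /edge_integral[C C0 HC] : (1 / 2 < s i)%R.
  apply: hs; first by rewrite leqnn/= !addSn -addnA -addnS leq_addr.
  by move/eqP; rewrite addSn ltn_eqF// ltnS leq_addr.
exists (C * K)%R; first exact: mulr_gt0.
move=> y z posl p0 pos.
set E := left_corr y z i; set p := (y i - E)%R.
have pi : (0 < p)%R by apply: posl; rewrite leqnn addSn ltnS leq_addr.
have mfull : measurable_fun setT (fun q : (MR * MR * MR) * (TR (d + k) * TR (d + k)) =>
    (path_density s y z d k i.+1 (q.1.2 :: q.2.1) q.2.2)%:E).
  apply/measurable_EFinP; apply: (@measurable_path_density _ _ s y z d k i.+1 (d + k).+1 _
     (fun q : (MR * MR * MR) * (TR (d + k) * TR (d + k)) => [tuple of q.1.2 :: q.2.1])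
     (fun q => q.2.2)).
    apply: measurable_cons.
      exact: (measurableT_comp measurable_snd measurable_fst).
    exact: (measurableT_comp measurable_fst measurable_snd).
  exact: (measurableT_comp measurable_snd measurable_snd).
pose H (a1 : R) := integral2 (fun x u : TR (d + k) => (path_density s y z d k i.+1 (a1 :: x) u)%:E).
have H0 a1 : 0 <= H a1 by apply: integral2_ge0 => x u; rewrite lee_fin path_density_ge0.
have mH : measurable_fun setT (fun q : MR * MR * MR => H q.2).
  by apply: measurable_integral2 => // q x u; rewrite lee_fin path_density_ge0.
have mxu (a1 : R) : measurable_fun setT (fun q : TR (d + k) * TR (d + k) =>
    (path_density s y z d k i.+1 (a1 :: q.1) q.2)%:E).
  apply: (measurableT_comp mfull (g := fun q : TR (d + k) * TR (d + k) => (((0%R, 0%R), a1) : MR * MR * MR, q))).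
  exact: measurable_fun_pair.
(* The first vertex only interacts with the diagonal entry [a1] of the second one,
   so it can be integrated out for fixed [a1]. *)
transitivity (\int[mu]_a \int[mu]_b \int[mu]_a1
   ((expR (- (p * a) - 2 * z i * b) * edge_kernel (s i) a b a1)%:E * H a1)).
  apply: eq_integral => a _.
  rewrite (@integral2_cons _ (d + k) (fun x u => (expR (E * a) * path_density s y z d.+1 k i (a :: x) u)%:E)); last 2 first.
  - apply/measurable_EFinP; apply: measurable_funM => //.
    apply: (@measurable_path_density _ _ s y z d.+1 k i (d + k).+2 (d + k).+1
      (fun q : TR (d + k).+1 * TR (d + k).+1 => [tuple of a :: q.1]) snd).
      by apply: measurable_cons => //; exact: measurable_fst.
    exact: measurable_snd.
  - by move=> x u; rewrite lee_fin mulr_ge0 ?expR_ge0 ?path_density_ge0.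
  apply: eq_integral => b _; apply: eq_integral => a1 _.
  transitivity (integral2 (fun x u : TR (d + k) =>
     (expR (- (p * a) - 2 * z i * b) * edge_kernel (s i) a b a1)%:E *
     (path_density s y z d k i.+1 (a1 :: x) u)%:E)).
    apply: eq_integral => x _; apply: eq_integral => u _; rewrite path_density_cons -EFinM.
    congr EFin; rewrite /left_weight /=.
    rewrite (_ : - (p * a) - 2 * z i * b = E * a + (- (y i * a) - 2 * z i * b))%R; last first.
      by rewrite /p; ring.
    by rewrite [in RHS]expRD; ring.
  rewrite integral2Zl ?mulr_ge0 ?expR_ge0 ?edge_kernel_ge0//.
  by move=> x u; rewrite lee_fin path_density_ge0.
rewrite (@fubini_swap3 _ (fun a b a1 =>
    (expR (- (p * a) - 2 * z i * b) * edge_kernel (s i) a b a1)%:E * H a1)); last 2 first.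
- apply: emeasurable_funM => //; apply/measurable_EFinP; apply: measurable_edge_weight.
  + exact: (measurableT_comp measurable_fst measurable_fst).
  + exact: (measurableT_comp measurable_snd measurable_fst).
  + exact: measurable_snd.
- by move=> a b a1; rewrite mule_ge0// lee_fin mulr_ge0 ?expR_ge0 ?edge_kernel_ge0.
have HD a1 : integral2 (fun x u : TR (d + k) =>
       (expR (left_corr y z i.+1 * a1) * path_density s y z d k i.+1 (a1 :: x) u)%:E) =
       (expR (left_corr y z i.+1 * a1))%:E * H a1.
  by rewrite -integral2Zl ?expR_ge0// => x u; rewrite lee_fin path_density_ge0.
transitivity (\int[mu]_a1 ((C * p `^ (- s i))%:E *
   integral2 (fun x u : TR (d + k) =>
       (expR (left_corr y z i.+1 * a1) * path_density s y z d k i.+1 (a1 :: x) u)%:E))).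
  apply: eq_integral => a1 _; rewrite HD.
  case: (ltP 0%R a1) => a10; last first.
    have -> : H a1 = 0.
      rewrite /H /integral2 integral0_eq// => x _; rewrite integral0_eq// => u _.
      by rewrite path_density_head_le0.
    rewrite !mule0 integral0_eq// => b _; rewrite integral0_eq// => a _.
    by rewrite mule0.
  under eq_integral do under eq_integral do rewrite muleC.
  rewrite (edge_integralZ _ _ (HC p (z i) a1 pi a10))//.
    by rewrite muleC EFinM -muleA /= -/E -/p (mulrC a1).
  by rewrite !mulr_gt0 ?powR_gt0 ?expR_gt0.
rewrite ge0_integralZl//; last 3 first.
- have mH1 : measurable_fun setT H.
    apply: (measurableT_comp mH (g := fun a1 : MR => ((0%R, 0%R), a1) : MR * MR * MR)).
    exact: measurable_fun_pair.
  rewrite (_ : (fun a1 => _) = fun a1 => (expR (left_corr y z i.+1 * a1))%:E * H a1); last first.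
    by apply/funext => a1; exact: HD.
  apply: emeasurable_funM => //; apply/measurable_EFinP.
  by apply: measurableT_comp => //; exact: measurable_funM.
- by move=> a1 _; rewrite HD mule_ge0// lee_fin expR_ge0.
- by rewrite lee_fin mulr_ge0 ?powR_ge0// ltW.
rewrite HK//; last by move=> j /andP[ij jd]; apply: posl; rewrite (ltnW ij).
rewrite -EFinM; congr EFin.
rewrite [in RHS]big_ltn; last by rewrite addSn ltnS leq_addr.
rewrite -/E -/p !opprD !expRD /powR gt_eqF//.
rewrite (_ : - (s i * ln p) = - s i * ln p)%R; last by ring.
ring.
Qed.
End PathIntegral.

(** * The derivative of the logarithms of the pivots *)

Section LogPivots.
Context {R : realType}.
Implicit Types (f g : R -> R) (x df dg : R).

Lemma is_derive_subf f g x df dg : is_derive x 1 f df -> is_derive x 1 g dg ->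
  is_derive x 1 (fun t => f t - g t) (df - dg).
Proof. by move=> ? ?; exact: (is_deriveB (f := f) (g := g)). Qed.

Lemma is_derive_addf f g x df dg : is_derive x 1 f df -> is_derive x 1 g dg ->
  is_derive x 1 (fun t => f t + g t) (df + dg).
Proof. by move=> ? ?; exact: (is_deriveD (f := f) (g := g)). Qed.

Lemma is_derive_mulf f g x df dg : is_derive x 1 f df -> is_derive x 1 g dg ->
  is_derive x 1 (fun t => f t * g t) (f x * dg + g x * df).
Proof. by move=> ? ?; exact: (is_deriveM (f := f) (g := g)). Qed.

Lemma is_derive_invf f x df : f x != 0 -> is_derive x 1 f df ->
  is_derive x 1 (fun t => (f t)^-1) (- (f x) ^- 2 * df).
Proof. by move=> ? ?; exact: is_deriveV. Qed.

Lemma is_derive_constf (c : R) x : is_derive x 1 (fun=> c) 0.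
Proof. exact: is_derive_cst. Qed.

Lemma is_derive_affine (a b : R) x : is_derive x 1 (fun t => a + t * b) b.
Proof.
apply: (is_derive_eq (is_derive_addf (is_derive_constf a x) (is_derive_mulf (is_derive_id x 1) (is_derive_constf b x)))).
by rewrite mulr0 add0r mulr1 add0r.
Qed.

Lemma is_derive_lnf f x df : 0 < f x -> is_derive x 1 f df ->
  is_derive x 1 (fun t => ln (f t)) (df / f x).
Proof.
move=> f0 fd; rewrite mulrC.
exact: (@is_derive1_comp R (@ln R) f x _ _ (is_derive1_ln f0) fd).
Qed.

Lemma near_gt0 f x df : is_derive x 1 f df -> 0 < f x -> \forall t \near x, 0 < f t.
Proof.
move=> fd f0; have fc : {for x, continuous f}.
  by apply: differentiable_continuous; apply/derivable1_diffP; exact: ex_derive.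
exact: cvgr_gt fc _ f0.
Qed.

(** The difference quotient at [0] is at most [- E] on the left and at least [- E] on
    the right. *)
Lemma is_derive_supporting_line f (D E : R) : is_derive (0 : R) 1 f D -> f 0 = 1 ->
  (\forall t \near (0 : R), 1 - t * E <= f t) -> D = - E.
Proof.
move=> [fd fD] f01 fE.
have c : h^-1 * (f h - 1) @[h --> (0 : R)^'] --> D.
  move: fd => /cvg_ex[l Hl]; rewrite -fD /derive (cvg_lim _ Hl)//.
  apply: cvg_trans Hl; apply: near_eq_cvg; apply: nearW => t /=.
  by rewrite addr0 f01 /GRing.scale/= mulr1.
have sl : (0 : R)^'- `=>` (0 : R)^'.
  by move=> P; rewrite /at_left /dnbhs /within /=; apply: (@filterS _ (nbhs (0 : R))) => u Pu u0; apply: Pu; rewrite lt_eqF.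
have sr : (0 : R)^'+ `=>` (0 : R)^'.
  by move=> P; rewrite /at_right /dnbhs /within /=; apply: (@filterS _ (nbhs (0 : R))) => u Pu u0; apply: Pu; rewrite gt_eqF.
have nl : \forall t \near (0 : R)^'-, 1 - t * E <= f t by exact: (cvg_within _).
have nr : \forall t \near (0 : R)^'+, 1 - t * E <= f t by exact: (cvg_within _).
apply/eqP; rewrite eq_le; apply/andP; split.
- apply: (cvgr_to_le (cvg_trans (cvg_app _ sl) c)).
  near=> t; have t0 : t < 0 by [].
  have : 1 - t * E <= f t by near: t.
  rewrite ler_ndivrMl// => H; lra.
- apply: (cvgr_to_ge (cvg_trans (cvg_app _ sr) c)).
  near=> t; have t0 : 0 < t by [].
  have : 1 - t * E <= f t by near: t.
  rewrite ler_pdivlMl// => H; lra.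
Unshelve. all: by end_near. Qed.

Variables (y z h g : nat -> R).
Let yt (t : R) j := y j + t * h j.
Let zt (t : R) j := z j + t * g j.

Fixpoint left_corr_deriv (i : nat) : R :=
  if i is i'.+1 then
    let l := y i' - left_corr y z i' in
    2 * z i' * g i' / l - z i' ^+ 2 * (h i' - left_corr_deriv i') / l ^+ 2
  else 0.

Fixpoint right_corr_deriv (k i : nat) : R :=
  if k is k'.+1 then
    let r := y i.+1 - right_corr y z k' i.+1 in
    2 * z i * g i / r - z i ^+ 2 * (h i.+1 - right_corr_deriv k' i.+1) / r ^+ 2
  else 0.

Lemma yt_0 : yt 0 = y. Proof. by apply/funext => j; rewrite /yt mul0r addr0. Qed.
Lemma zt_0 : zt 0 = z. Proof. by apply/funext => j; rewrite /zt mul0r addr0. Qed.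

(** Both continued fractions have this shape. *)
Lemma is_derive_corr (l : R -> R) (dl : R) i : l 0 != 0 -> is_derive (0 : R) 1 l dl ->
  is_derive (0 : R) 1 (fun t => zt t i ^+ 2 / l t)
    (2 * z i * g i / l 0 - z i ^+ 2 * dl / l 0 ^+ 2).
Proof.
move=> l0 ld.
apply: (is_derive_eq (is_derive_mulf (is_derive_mulf (is_derive_affine (z i) (g i) 0) (is_derive_affine (z i) (g i) 0)) (is_derive_invf l0 ld))).
by rewrite mul0r addr0; field.
Qed.

Lemma is_derive_left_corr i : (forall j, (j < i)%N -> 0 < y j - left_corr y z j) ->
  is_derive (0 : R) 1 (fun t => left_corr (yt t) (zt t) i) (left_corr_deriv i).
Proof.
elim: i => [|i IH] pos; first exact: is_derive_constf.
have /IH{}IH : forall j, (j < i)%N -> 0 < y j - left_corr y z j.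
  by move=> j ji; apply: pos; exact: ltnW.
have := @is_derive_corr (fun t => yt t i - left_corr (yt t) (zt t) i) _ i _ (is_derive_subf (is_derive_affine _ _ _) IH).
by rewrite /= yt_0 zt_0; apply; rewrite gt_eqF// pos.
Qed.

Lemma is_derive_right_corr k i : right_pivots_gt0 y z k i ->
  is_derive (0 : R) 1 (fun t => right_corr (yt t) (zt t) k i) (right_corr_deriv k i).
Proof.
elim: k i => [|k IH] i; first by move=> _; exact: is_derive_constf.
move=> /= /andP[p0 /IH{}IH].
have := @is_derive_corr (fun t => yt t i.+1 - right_corr (yt t) (zt t) k i.+1) _ i _ (is_derive_subf (is_derive_affine _ _ _) IH).
by rewrite /= yt_0 zt_0; apply; rewrite gt_eqF// pos.
Qed.

Lemma near_left_pivots_gt0 i : (forall j, (j < i)%N -> 0 < y j - left_corr y z j) ->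
  \forall t \near (0 : R), forall j, (j < i)%N -> 0 < yt t j - left_corr (yt t) (zt t) j.
Proof.
elim: i => [|i IH] pos; first by near=> t => j.
have pos' : forall j, (j < i)%N -> 0 < y j - left_corr y z j.
  by move=> j ji; apply: pos; exact: ltnW.
have di := is_derive_left_corr pos'; have {}IH := IH pos'.
have := near_gt0 (is_derive_subf (is_derive_affine (y i) (h i) 0) di); rewrite mul0r addr0 yt_0 zt_0.
move=> /(_ (pos _ (ltnSn _))) H; near=> t => j; rewrite ltnS leq_eqVlt => /predU1P[->|ji].
  by near: t.
by move: j ji; near: t.
Unshelve. all: by end_near. Qed.

Lemma near_right_pivots_gt0 k i : right_pivots_gt0 y z k i -> \forall t \near (0 : R), right_pivots_gt0 (yt t) (zt t) k i.
Proof.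
elim: k i => [|k IH] i; first by move=> _; near=> t.
move=> /= /andP[p0 /[dup]/is_derive_right_corr di /IH{}IH].
have := near_gt0 (is_derive_subf (is_derive_affine (y i.+1) (h i.+1) 0) di); rewrite mul0r addr0 yt_0 zt_0.
move=> /(_ p0) H; near=> t; apply/andP; split; first by near: t.
by near: t.
Unshelve. all: by end_near. Qed.

Lemma near_root_pivot_gt0 m k : (forall j, (j < m)%N -> 0 < y j - left_corr y z j) -> right_pivots_gt0 y z k m ->
  0 < y m - left_corr y z m - right_corr y z k m ->
  \forall t \near (0 : R), 0 < yt t m - left_corr (yt t) (zt t) m - right_corr (yt t) (zt t) k m.
Proof.
move=> /is_derive_left_corr dl /is_derive_right_corr dr p0.
have := near_gt0 (is_derive_subf (is_derive_subf (is_derive_affine (y m) (h m) 0) dl) dr).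
by rewrite mul0r addr0 yt_0 zt_0; exact.
Qed.

Variables (s Fd Fo : nat -> R).

(** [Fd] and [Fo] are meant to be the diagonal and off-diagonal entries of the mean;
    these are its relations from the right, for the [k] vertices following [i]. *)
Fixpoint right_rels k i : Prop :=
  if k is k'.+1 then
    let r := y i.+1 - right_corr y z k' i.+1 in
    [/\ Fo i = - (z i / r) * Fd i, Fd i.+1 = s i.+1 / r + (z i / r) ^+ 2 * Fd i & right_rels k' i.+1]
  else True.

(** By the relations, [s_i dl_i / l_i] is
    [h_i Fd_i + 2 g_i Fo_i + Fd_(i+1) d_(i+1) - Fd_i d_i], where [l_i] is the pivot and
    [d_i] the derivative of [left_corr], so the sum telescopes. *)
Lemma is_derive_left_log_pivots m : (forall j, (j < m)%N -> 0 < y j - left_corr y z j) ->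
  (forall i, (i < m)%N -> let l := y i - left_corr y z i in
     Fo i = - (z i / l) * Fd i.+1 /\ Fd i = s i / l + (z i / l) ^+ 2 * Fd i.+1) ->
  is_derive (0 : R) 1 (fun t => \sum_(0 <= j < m) s j * ln (yt t j - left_corr (yt t) (zt t) j))
    (\sum_(0 <= j < m) (h j * Fd j + 2 * g j * Fo j) + Fd m * left_corr_deriv m).
Proof.
elim: m => [|m IH] pos rel.
  rewrite (_ : (fun t => _) = fun=> 0); last by apply/funext => t; rewrite big_geq.
  by rewrite big_geq//= mulr0 addr0; exact: is_derive_constf.
have pos' j : (j < m)%N -> 0 < y j - left_corr y z j by move=> jm; apply: pos; exact: ltnW.
have rel' j (jm : (j < m)%N) := rel j (ltnW jm).
have d1 := IH pos' rel'; have d2 := is_derive_left_corr pos'.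
rewrite (_ : (fun t => _) = fun t =>
    \sum_(0 <= j < m) s j * ln (yt t j - left_corr (yt t) (zt t) j) +
    s m * ln (yt t m - left_corr (yt t) (zt t) m)); last first.
  by apply/funext => t; rewrite big_nat_recr.
have lm := pos m (ltnSn _).
have d3 := @is_derive_lnf (fun t => yt t m - left_corr (yt t) (zt t) m) 0 _ _ (is_derive_subf (is_derive_affine _ _ _) d2).
rewrite yt_0 zt_0 in d3.
apply: (is_derive_eq (is_derive_addf d1 (is_derive_mulf (is_derive_constf (s m) 0) (d3 lm)))).
have [E1 E2] := rel m (ltnSn _).
rewrite big_nat_recr//= E1 E2 -!addrA; congr (_ + _).
by rewrite mulr0 addr0; field; rewrite gt_eqF.
Qed.

Lemma is_derive_right_log_pivots k i : right_pivots_gt0 y z k i -> right_rels k i ->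
  is_derive (0 : R) 1 (fun t => right_log_pivots s (yt t) (zt t) k i)
    (\sum_(i <= j < i + k) (h j.+1 * Fd j.+1 + 2 * g j * Fo j) + Fd i * right_corr_deriv k i).
Proof.
elim: k i => [|k IH] i.
  by move=> _ _; rewrite addn0 big_geq//= mulr0 addr0; exact: is_derive_constf.
move=> /= /andP[p0 pos] [E1 E2 rel].
have d1 := IH _ pos rel; have d2 := is_derive_right_corr pos.
have d3 := @is_derive_lnf (fun t => yt t i.+1 - right_corr (yt t) (zt t) k i.+1) 0 _ _ (is_derive_subf (is_derive_affine _ _ _) d2).
rewrite yt_0 zt_0 in d3.
apply: (is_derive_eq (is_derive_addf (is_derive_mulf (is_derive_constf (s i.+1) 0) (d3 p0)) d1)).
rewrite [in RHS]big_ltn ?addnS ?ltnS ?leq_addr// addSn E1 E2.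
by field; rewrite gt_eqF.
Qed.

(** The negative logarithm of the Laplace transform, up to a constant. *)
Definition log_pivots (y z : nat -> R) m k := \sum_(0 <= j < m) s j * ln (y j - left_corr y z j) +
  s m * ln (y m - left_corr y z m - right_corr y z k m) + right_log_pivots s y z k m.

(** The boundary terms of the two telescoping sums are those of the derivative of the
    pivot of the root. *)
Lemma is_derive_log_pivots m k : (forall j, (j < m)%N -> 0 < y j - left_corr y z j) ->
  right_pivots_gt0 y z k m -> 0 < y m - left_corr y z m - right_corr y z k m ->
  (forall i, (i < m)%N -> let l := y i - left_corr y z i in
     Fo i = - (z i / l) * Fd i.+1 /\ Fd i = s i / l + (z i / l) ^+ 2 * Fd i.+1) ->
  right_rels k m -> Fd m = s m / (y m - left_corr y z m - right_corr y z k m) ->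
  is_derive (0 : R) 1 (fun t => log_pivots (yt t) (zt t) m k)
    (\sum_(0 <= j < (m + k).+1) h j * Fd j + 2 * \sum_(0 <= j < m + k) g j * Fo j).
Proof.
move=> pl pr p0 rl rr rm.
have d3 := @is_derive_lnf (fun t => yt t m - left_corr (yt t) (zt t) m - right_corr (yt t) (zt t) k m) 0 _ _
  (is_derive_subf (is_derive_subf (is_derive_affine _ _ _) (is_derive_left_corr pl)) (is_derive_right_corr pr)).
rewrite yt_0 zt_0 in d3.
apply: (is_derive_eq (is_derive_addf (is_derive_addf (is_derive_left_log_pivots pl rl) (is_derive_mulf (is_derive_constf (s m) 0) (d3 p0))) (is_derive_right_log_pivots pr rr))).
rewrite (@big_cat_nat _ _ _ m 0 (m + k).+1)//=; last by rewrite -addnS leq_addr.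
rewrite (@big_cat_nat _ _ _ m 0 (m + k))//=; last by rewrite leq_addr.
rewrite [\sum_(m <= j < (m + k).+1) _]big_ltn; last by rewrite ltnS leq_addr.
rewrite big_add1 /= !big_split /=.
have e2 a b : \sum_(a <= j < b) 2 * g j * Fo j = 2 * \sum_(a <= j < b) g j * Fo j.
  by rewrite mulr_sumr; apply: eq_bigr => j _; rewrite mulrA.
rewrite !e2 rm.
by field; rewrite gt_eqF.
Qed.
End LogPivots.

(** * Inverses of tridiagonal matrices *)

Section PosDef.
Context {R : realType}.

Definition posdef k (A : 'M[R]_k) :=
  A^T = A /\ forall x : 'cV[R]_k, x != 0 -> 0 < (x^T *m A *m x) 0 0.

Lemma posdef_unit k (A : 'M[R]_k) : posdef A -> A \in unitmx.
Proof.
move=> [sA pA]; rewrite -row_free_unit -kermx_eq0; apply/eqP/row_matrixP => i.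
rewrite row0; set r := row i _.
have rA : r *m A = 0 by apply/sub_kermxP; exact: row_sub.
apply/eqP; apply: contraTT isT => r0.
have /pA : r^T != 0 by rewrite -(trmx0 R 1 k) (inj_eq trmx_inj).
by rewrite trmxK rA mul0mx mxE ltxx.
Qed.

Lemma posdef_inv_sym k (A : 'M[R]_k) : posdef A -> (invmx A)^T = invmx A.
Proof. by move=> [sA _]; rewrite trmx_inv sA. Qed.

(** The diagonal entry is the value of the form of [A] at a column of its inverse. *)
Lemma posdef_inv_diag_gt0 k (A : 'M[R]_k) i : posdef A -> 0 < invmx A i i.
Proof.
move=> /[dup] pdA /[dup] /posdef_unit uA [sA pA].
pose e : 'cV[R]_k := delta_mx i 0.
have e0 : invmx A *m e != 0.
  apply: contraTneq isT => /(congr1 (mulmx A)); rewrite mulmxA mulmxV// mul1mx mulmx0.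
  by move=> /matrixP/(_ i 0); rewrite !mxE !eqxx/= => /eqP; rewrite oner_eq0.
have := pA _ e0; rewrite trmx_mul posdef_inv_sym// -!mulmxA (mulmxA A) mulmxV// mul1mx.
by rewrite -colE trmx_delta -rowE !mxE.
Qed.
End PosDef.

Section Selection.
Context {R : realType} (n : nat) (B : {set 'I_n}).

Definition selmx : 'M[R]_(#|B|, n) := \matrix_(a, u) (enum_val a == u)%:R.

Lemma selmx_mulE m (A : 'M[R]_(n, m)) a w : (selmx *m A) a w = A (enum_val a) w.
Proof.
rewrite mxE (bigD1 (enum_val a))//= mxE eqxx mul1r big1 ?addr0// => u uB.
by rewrite mxE eq_sym (negbTE uB) mul0r.
Qed.

Lemma psubE (A : 'M[R]_n) : psub A B = selmx *m A *m selmx^T.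
Proof.
apply/matrixP => a b; rewrite -mulmxA selmx_mulE -[in RHS](trmxK (A *m _)) [RHS]mxE.
by rewrite trmx_mul trmxK selmx_mulE !mxE.
Qed.

Lemma selmx_trK : selmx *m selmx^T = 1%:M.
Proof.
by apply/matrixP => a b; rewrite selmx_mulE !mxE (inj_eq enum_val_inj) eq_sym.
Qed.

(** Extension by zero and extraction of a block are conjugation by the selection
    matrix, which reduces the truncated inverses to matrix algebra. *)
Lemma zextE (K : 'M[R]_#|B|) : zext K = selmx^T *m K *m selmx.
Proof.
have S (u : 'I_n) m (A : 'M[R]_(#|B|, m)) w : (selmx^T *m A) u w =
    if [pick a : 'I_#|B| | enum_val a == u] is Some a then A a w else 0.
  rewrite mxE; case: pickP => [a /eqP au|nou].
    rewrite (bigD1 a)//= !mxE au eqxx mul1r big1 ?addr0// => b ba.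
    by rewrite !mxE -au (inj_eq enum_val_inj) (negbTE ba) mul0r.
  by rewrite big1// => a _; rewrite !mxE nou mul0r.
apply/matrixP => u v; rewrite -mulmxA S mxE; case: pickP => // a _.
rewrite -[K *m _]trmxK [RHS]mxE trmx_mul S; case: pickP => // b _.
by rewrite mxE.
Qed.

Lemma zext_val (K : 'M[R]_#|B|) a b : zext K (enum_val a) (enum_val b) = K a b.
Proof.
rewrite mxE; case: pickP => [a' /eqP/enum_val_inj ->|/(_ a)]; last by rewrite eqxx.
by case: pickP => [b' /eqP/enum_val_inj ->|/(_ b)]; last by rewrite eqxx.
Qed.

Lemma posdef_psub (A : 'M[R]_n) : posdef A -> posdef (psub A B).
Proof.
move=> [sA pA]; split; first by rewrite psubE !trmx_mul trmxK sA mulmxA.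
move=> x x0; rewrite psubE.
have := pA (selmx^T *m x); rewrite trmx_mul trmxK !mulmxA; apply.
apply: contraNneq x0 => /(congr1 (mulmx selmx)).
by rewrite mulmxA selmx_trK mul1mx mulmx0 => ->.
Qed.

End Selection.

Section Tridiagonal.
Context {R : realType} (N : nat) (y : 'M[R]_N.+1).
Hypothesis yZG : ZG y.
Implicit Types W : 'M[R]_N.+1.

(** Natural indices avoid casts between ordinals in the recursions along the path. *)
Definition mx_nth W (i j : nat) : R := W (inord i) (inord j).
Definition mdiag (j : nat) : R := mx_nth y j j.
Definition moff (j : nat) : R := mx_nth y j j.+1.

Lemma ZG_sym u v : y u v = y v u.
Proof. by have [sy _] := yZG; rewrite -{1}sy mxE. Qed.

Lemma mx_nth_sym W i j : W^T = W -> mx_nth W i j = mx_nth W j i.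
Proof. by rewrite /mx_nth => sW; rewrite -{1}sW mxE. Qed.

Lemma mx_nth_ord W (u v : 'I_N.+1) : mx_nth W u v = W u v.
Proof. by rewrite /mx_nth !inord_val. Qed.

Lemma ZG_row_mul W (u w : nat) : (u <= N)%N ->
  (y *m W) (inord u) (inord w) =
  (if u is u'.+1 then moff u' * mx_nth W u' w else 0) + mdiag u * mx_nth W u w +
  (if (u < N)%N then moff u * mx_nth W u.+1 w else 0).
Proof.
move=> uN; rewrite mxE.
transitivity (\sum_(v < N.+1) (
   (if (if u is u'.+1 then v == inord u' else false) then moff u.-1 * mx_nth W v w else 0) +
   (if v == inord u then mdiag u * mx_nth W v w else 0) +
   (if (u < N)%N && (v == inord u.+1) then moff u * mx_nth W v w else 0))).
  apply: eq_bigr => v _.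
  have eqv j : (j <= N)%N -> (v == inord j) = (v == j :> nat).
    by move=> jN; rewrite -(inj_eq val_inj) /= inordK.
  have H1 : (if u is u'.+1 then v == inord u' else false) = (u == v.+1).
    case: u uN => [|u'] uN; first by [].
    by rewrite eqv ?(ltnW uN)// eqSS eq_sym.
  have H2 : (u < N)%N && (v == inord u.+1) = (v == u.+1 :> nat).
    case: (ltnP u N) => uN' /=; first by rewrite eqv.
    apply/esym/negbTE; rewrite neq_ltn; apply/orP; left.
    by rewrite (leq_trans (ltn_ord v)).
  rewrite H1 H2 eqv// /mx_nth inord_val.
  have [uv1|uv1] := eqVneq u v.+1.
    rewrite uv1 /= (ltn_eqF (ltnSn v)) (@ltn_eqF v v.+2)// !addr0 /moff /mx_nth.
    by rewrite ZG_sym inord_val.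
  have [vu|vu] := eqVneq (v : nat) u.
    by rewrite -vu (ltn_eqF (ltnSn v)) add0r addr0 /mdiag /mx_nth inord_val.
  rewrite !add0r; have [vu1|vu1] := eqVneq (v : nat) u.+1.
    by rewrite /moff /mx_nth -vu1 inord_val.
  have [_ ->] := yZG; rewrite ?mul0r// /edge inordK//.
  by apply/negP => /andP[a b]; move: uv1 vu vu1 a b; lia.
rewrite !big_split /=; congr (_ + _ + _).
- case: u uN => [|u'] uN; first by rewrite big1.
  by rewrite -big_mkcond big_pred1_eq /mx_nth inord_val.
- by rewrite -big_mkcond big_pred1_eq /mx_nth inord_val.
- case: (ltnP u N) => uN' /=; last by rewrite big1.
  by rewrite -big_mkcond big_pred1_eq /mx_nth inord_val.
Qed.

End Tridiagonal.

Section Elimination.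
Context {R : realType} (N : nat) (y : 'M[R]_N.+1).
Hypothesis yPG : PG y.
Implicit Types W : 'M[R]_N.+1.
Local Notation mdiag := (mdiag y).
Local Notation moff := (moff y).

Lemma PG_posdef : posdef y.
Proof. by case: yPG => -[]. Qed.

(** [W] is the inverse of the block of [y] on the vertices [p], ..., [q], extended by
    zero. *)
Record block_inv (p q : nat) W := {
  block_inv_sym : W^T = W;
  block_inv_out : forall u v : 'I_N.+1, ~~ (p <= u <= q)%N -> W u v = 0;
  block_inv_mul : forall u v : 'I_N.+1, (p <= u <= q)%N -> (y *m W) u v = (u == v)%:R;
  block_inv_diag_gt0 : forall u : 'I_N.+1, (p <= u <= q)%N -> 0 < W u u }.

Lemma block_inv_whole : block_inv 0 N (invmx y).
Proof.
have pd := PG_posdef.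
have inn (u : 'I_N.+1) : (0 <= u <= N)%N by rewrite /= -ltnS.
split => [|u v|u v _|u _].
- exact: posdef_inv_sym.
- by rewrite inn.
- by rewrite mulmxV ?posdef_unit// mxE.
- exact: posdef_inv_diag_gt0.
Qed.

Lemma block_inv_seg p q : block_inv p q (zext (invmx (psub y (seg N.+1 p.+1 q.+1)))).
Proof.
set B := seg _ _ _; set K := invmx _.
have pd : posdef (psub y B) by apply: posdef_psub; exact: PG_posdef.
have inB (u : 'I_N.+1) : (u \in B) = (p <= u <= q)%N by rewrite inE !ltnS.
have sK : K^T = K by exact: posdef_inv_sym.
split.
- by rewrite zextE !trmx_mul trmxK sK mulmxA.
- move=> u v; rewrite -inB => uB; rewrite mxE; case: pickP => // a /eqP au.
  by rewrite -au enum_valP in uB.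
- move=> u v; rewrite -inB => uB.
  rewrite -(enum_rankK_in uB uB) -selmx_mulE zextE !mulmxA -psubE.
  by rewrite mulmxV ?posdef_unit// mul1mx mxE.
- move=> u; rewrite -inB => uB; rewrite -(enum_rankK_in uB uB).
  rewrite zext_val; exact: posdef_inv_diag_gt0.
Qed.

Lemma block_inv_row p q W u w : block_inv p q W -> (p <= u <= q)%N -> (q <= N)%N -> (w <= N)%N ->
  (if u is u'.+1 then moff u' * mx_nth W u' w else 0) + mdiag u * mx_nth W u w +
  (if (u < N)%N then moff u * mx_nth W u.+1 w else 0) = (u == w)%:R.
Proof.
move=> iW /[dup] puq /andP[pu uq] qN wN; have uN := leq_trans uq qN.
rewrite -(ZG_row_mul yPG.1)// (block_inv_mul iW) ?inordK//.
by rewrite -(inj_eq val_inj) /= !inordK.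
Qed.

Local Notation left_corr := (left_corr mdiag moff).
Local Notation right_corr := (right_corr mdiag moff).

(** Gaussian elimination on the equations of column [w], from the first row to row
    [w]: the row [u] retains two unknowns, with the pivot as leading coefficient. *)
Lemma elim_left q W u w : block_inv 0 q W -> (q <= N)%N -> (w <= q)%N -> (u <= w)%N ->
  (forall j, (j < w)%N -> 0 < mdiag j - left_corr j) ->
  (mdiag u - left_corr u) * mx_nth W u w + (if (u < N)%N then moff u * mx_nth W u.+1 w else 0) = (u == w)%:R.
Proof.
move=> iW qN wq + pos; elim: u => [|u IH] uw.
  by rewrite -(block_inv_row iW _ qN (leq_trans wq qN))//= subr0 add0r.
have uN : (u < N)%N by rewrite (leq_trans uw)// (leq_trans wq).
have := IH (ltnW uw); rewrite uN (ltn_eqF uw) mulr0n => E1.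
rewrite -(block_inv_row iW _ qN (leq_trans wq qN)) ?(leq_trans uw)//=; congr (_ + _).
have p0 := pos _ uw.
have -> : mx_nth W u w = - (moff u * mx_nth W u.+1 w) / (mdiag u - left_corr u).
  by apply: (mulfI (lt0r_neq0 p0)); rewrite mulrCA mulfV ?lt0r_neq0// mulr1; lra.
by field; rewrite lt0r_neq0.
Qed.

Lemma elim_right p W k u w : block_inv p N W -> (u + k = N)%N -> (p <= w <= u)%N ->
  (forall j k', (w < j)%N -> (j + k' = N)%N -> 0 < mdiag j - right_corr k' j) ->
  (mdiag u - right_corr k u) * mx_nth W u w + (if u is u'.+1 then moff u' * mx_nth W u' w else 0) = (u == w)%:R.
Proof.
move=> iW ukN /andP[pw + ] pos; elim: k u ukN => [|k IH] u ukN wu.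
  rewrite addn0 in ukN; rewrite ukN in wu *.
  rewrite -(block_inv_row iW _ _ wu) ?(leq_trans pw)//= ltnn addr0 subr0 addrC//.
have uN : (u < N)%N by rewrite -ukN -[ltnLHS]addn0 ltn_add2l.
have ukN' : (u.+1 + k = N)%N by rewrite addSnnS.
have := IH u.+1 ukN' (leqW wu); rewrite (@gtn_eqF w u.+1)// mulr0n => E1.
rewrite -(block_inv_row iW _ _ (leq_trans wu (ltnW uN))) ?(leq_trans pw)// ?(ltnW uN)//= uN.
have p0 := pos _ _ (wu : (w < u.+1)%N) ukN'.
have -> : mx_nth W u.+1 w = - (moff u * mx_nth W u w) / (mdiag u.+1 - right_corr k u.+1).
  by apply: (mulfI (lt0r_neq0 p0)); rewrite mulrCA mulfV ?lt0r_neq0// mulr1; lra.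
by field; rewrite lt0r_neq0.
Qed.

Lemma mx_nth_out p q W u v : block_inv p q W -> (u <= N)%N -> ~~ (p <= u <= q)%N -> mx_nth W u v = 0.
Proof. by move=> iW uN uo; rewrite /mx_nth (block_inv_out iW)// inordK. Qed.

Lemma mx_nth_out_r p q W u v : block_inv p q W -> (v <= N)%N -> ~~ (p <= v <= q)%N -> mx_nth W u v = 0.
Proof. by move=> iW vN vo; rewrite mx_nth_sym ?(block_inv_sym iW)// (mx_nth_out _ iW). Qed.

Lemma mx_nth_gt0 p q W u : block_inv p q W -> (u <= N)%N -> (p <= u <= q)%N -> 0 < mx_nth W u u.
Proof. by move=> iW uN uo; rewrite /mx_nth (block_inv_diag_gt0 iW)// inordK. Qed.

(** The last equation for the inverse [W] of the leading block ending at [q] reads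
    [pivot_q * W_qq = 1], and [W_qq] is positive. *)
Lemma PG_left_pivot_gt0 q : (q <= N)%N -> 0 < mdiag q - left_corr q.
Proof.
elim/ltn_ind: q => q IH qN.
have iW := block_inv_seg 0 q.
have := elim_left iW qN (leqnn q) (leqnn q) (fun j jq => IH j jq (leq_trans (ltnW jq) qN)).
rewrite eqxx (_ : (if _ then _ else _) = 0); last first.
  by case: ltnP => // qN'; rewrite (mx_nth_out _ iW) ?mulr0// ltnn.
have p0 : 0 < mx_nth (zext (invmx (psub y (seg N.+1 1 q.+1)))) q q by rewrite (mx_nth_gt0 iW)/=.
rewrite addr0 => E; rewrite -(pmulr_lgt0 _ p0) E; exact: ltr01.
Qed.

Lemma PG_right_pivot_gt0 k q : (q + k = N)%N -> 0 < mdiag q - right_corr k q.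
Proof.
elim/ltn_ind: k q => k IH q qkN.
have qN : (q <= N)%N by rewrite -qkN leq_addr.
have iW := block_inv_seg q N.
have := elim_right iW qkN (_ : (q <= q <= q)%N) _.
rewrite leqnn eqxx => /(_ isT) H.
have {}H := H _.
rewrite (_ : match q with 0 => _ | _ => _ end = 0) ?addr0 in H; last first.
  by case: (q) qN iW => [//|q'] qN iW; rewrite (mx_nth_out _ iW) ?mulr0 ?ltnn// ltnW.
have p0 : 0 < mx_nth (zext (invmx (psub y (seg N.+1 q.+1 N.+1)))) q q.
  by rewrite (mx_nth_gt0 iW)// leqnn.
rewrite -(pmulr_lgt0 _ p0) H ?ltr01// => j k' qj jkN; apply: IH => //; lia.
Qed.

Lemma PG_right_pivots_gt0 k i : (i + k = N)%N -> right_pivots_gt0 mdiag moff k i.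
Proof.
elim: k i => [//|k IH] i ikN /=; have ikN' : (i.+1 + k = N)%N by rewrite addSnnS.
by rewrite PG_right_pivot_gt0// IH.
Qed.

Lemma inv_root m k : (m + k = N)%N ->
  (mdiag m - left_corr m - right_corr k m) * mx_nth (invmx y) m m = 1.
Proof.
move=> mkN; have mN : (m <= N)%N by rewrite -mkN leq_addr.
have iW := block_inv_whole.
have := elim_left iW (leqnn N) mN (leqnn m) (fun j jm => PG_left_pivot_gt0 (leq_trans (ltnW jm) mN)).
rewrite eqxx mulr1n => E; rewrite -[RHS]E {E}; case: k mkN => [|k] mkN.
  by rewrite (_ : (m < N)%N = false) ?addr0 ?subr0//; lia.
have mkN' : (m.+1 + k = N)%N by rewrite addSnnS.
have m1N : (m < N)%N by rewrite -mkN' leq_addr.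
have := @elim_right 0 _ k m.+1 m iW mkN' (_ : (0 <= m <= m.+1)%N) (fun j k' _ jk => PG_right_pivot_gt0 jk).
rewrite leqnSn (@gtn_eqF m m.+1)// mulr0n => /(_ isT) E1.
rewrite m1N /=.
have p0 := PG_right_pivot_gt0 mkN'.
have -> : mx_nth (invmx y) m.+1 m = - (moff m * mx_nth (invmx y) m m) / (mdiag m.+1 - right_corr k m.+1).
  by apply: (mulfI (lt0r_neq0 p0)); rewrite mulrCA mulfV ?lt0r_neq0// mulr1; lra.
by field; rewrite lt0r_neq0.
Qed.

Lemma PG_root_pivot_gt0 m k : (m + k = N)%N -> 0 < mdiag m - left_corr m - right_corr k m.
Proof.
move=> mkN; have mN : (m <= N)%N by rewrite -mkN leq_addr.
have p0 : 0 < mx_nth (invmx y) m m by rewrite (mx_nth_gt0 block_inv_whole).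
by rewrite -(pmulr_lgt0 _ p0) inv_root// ltr01.
Qed.

(** Relations between neighbouring entries, linear in the pair of [c] and [W]. *)
Definition left_rel i (c : R) W :=
  mx_nth W i i.+1 = - (moff i / (mdiag i - left_corr i)) * mx_nth W i.+1 i.+1 /\
  mx_nth W i i = c / (mdiag i - left_corr i) + (moff i / (mdiag i - left_corr i)) ^+ 2 * mx_nth W i.+1 i.+1.

Definition right_rel i k (c : R) W :=
  mx_nth W i i.+1 = - (moff i / (mdiag i.+1 - right_corr k i.+1)) * mx_nth W i i /\
  mx_nth W i.+1 i.+1 = c / (mdiag i.+1 - right_corr k i.+1) + (moff i / (mdiag i.+1 - right_corr k i.+1)) ^+ 2 * mx_nth W i i.

Lemma left_rel_inv i q W : block_inv 0 q W -> (q <= N)%N -> (i < N)%N -> left_rel i (i <= q)%:R W.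
Proof.
move=> iW qN iN; have l0 := PG_left_pivot_gt0 (ltnW iN).
have pos w : (w <= N)%N -> forall j, (j < w)%N -> 0 < mdiag j - left_corr j.
  by move=> wN j jw; apply: PG_left_pivot_gt0; rewrite (leq_trans (ltnW jw)).
rewrite /left_rel; case: (ltngtP i q) => iq.
- have := elim_left iW qN iq (leqnSn i) (pos _ iN).
  have := elim_left iW qN (ltnW iq) (leqnn i) (pos _ (ltnW iN)).
  rewrite iN eqxx (ltn_eqF (ltnSn i)) mulr0n => E1 E2.
  have E3 : mx_nth W i i.+1 = - (moff i / (mdiag i - left_corr i)) * mx_nth W i.+1 i.+1.
    by apply: (mulfI (lt0r_neq0 l0)); rewrite mulNr mulrN mulrA mulrCA mulfV ?lt0r_neq0// mulr1; lra.
  split=> //; rewrite (mx_nth_sym i.+1 i (block_inv_sym iW)) E3 in E1.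
  apply: (mulfI (lt0r_neq0 l0)); rewrite mulrDr mulrCA mulfV ?lt0r_neq0// mulr1 -E1.
  by field; rewrite lt0r_neq0.
- rewrite !(mx_nth_out _ iW) ?(ltnW iN)// -?ltnNge ?(leqW iq)//; last 1 first.
  by rewrite mul0r !mulr0 addr0.
- rewrite -iq in iW qN *.
  have := elim_left iW qN (leqnn i) (leqnn i) (pos _ (ltnW iN)).
  rewrite iN eqxx (mx_nth_out _ iW (u := i.+1)) ?ltnn// mulr0 addr0 => E1.
  rewrite (mx_nth_out_r _ iW) ?ltnn// (mx_nth_out _ iW (u := i.+1)) ?ltnn// !mulr0 addr0; split=> //.
  by apply: (mulfI (lt0r_neq0 l0)); rewrite mulrCA mulfV ?lt0r_neq0// mulr1.
Qed.

(** A block to the right of the edge vanishes at its two vertices. *)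
Lemma left_rel_out i p W : block_inv p N W -> (i.+1 < p)%N -> (i < N)%N -> left_rel i 0 W.
Proof.
move=> iW ip iN.
have o1 : ~~ (p <= i <= N)%N by lia.
have o2 : ~~ (p <= i.+1 <= N)%N by lia.
rewrite /left_rel !(mx_nth_out _ iW _ o1) ?(ltnW iN)// !(mx_nth_out _ iW _ o2)//.
by rewrite mul0r !mulr0 addr0.
Qed.

Lemma right_rel_inv i k p W : block_inv p N W -> (i.+1 + k = N)%N -> right_rel i k (p <= i.+1)%:R W.
Proof.
move=> iW ikN; have l0 := PG_right_pivot_gt0 ikN.
have iN : (i < N)%N by rewrite -ikN leq_addr.
have pos w : forall j k', (w < j)%N -> (j + k' = N)%N -> 0 < mdiag j - right_corr k' j.
  by move=> j k' _; exact: PG_right_pivot_gt0.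
rewrite /right_rel; case: (ltngtP p i.+1) => ip.
- rewrite ltnS in ip.
  have := elim_right iW ikN (_ : (p <= i <= i.+1)%N) (@pos _).
  have := elim_right iW ikN (_ : (p <= i.+1 <= i.+1)%N) (@pos _).
  rewrite ip (leqW ip) leqnn leqnSn eqxx (gtn_eqF (ltnSn i)) mulr0n => /(_ isT) E1 /(_ isT) E2.
  rewrite (mx_nth_sym i.+1 i (block_inv_sym iW)) in E2.
  have E3 : mx_nth W i i.+1 = - (moff i / (mdiag i.+1 - right_corr k i.+1)) * mx_nth W i i.
    by apply: (mulfI (lt0r_neq0 l0)); rewrite mulNr mulrN mulrA mulrCA mulfV ?lt0r_neq0// mulr1; lra.
  split=> //; rewrite E3 in E1.
  apply: (mulfI (lt0r_neq0 l0)); rewrite mulrDr mulrCA mulfV ?lt0r_neq0// mulr1 -E1.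
  by field; rewrite lt0r_neq0.
- rewrite !(mx_nth_out _ iW) ?(ltnW iN)// ?negb_and -?ltnNge ?ip ?(ltnW ip)//.
  by rewrite mul0r !mulr0 addr0.
- rewrite ip in iW *.
  have := elim_right iW ikN (_ : (i.+1 <= i.+1 <= i.+1)%N) (@pos _).
  rewrite leqnn eqxx (mx_nth_out _ iW (u := i)) ?ltnn ?(ltnW iN)// mulr0 addr0 => /(_ isT) E1.
  rewrite !(mx_nth_out _ iW (u := i)) ?ltnn ?(ltnW iN)// !mulr0 addr0; split=> //.
  by apply: (mulfI (lt0r_neq0 l0)); rewrite mulrCA mulfV ?lt0r_neq0// mulr1.
Qed.

Lemma right_rel_out i k q W : block_inv 0 q W -> (q < i)%N -> (i.+1 + k = N)%N -> right_rel i k 0 W.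
Proof.
move=> iW qi ikN; have iN : (i < N)%N by rewrite -ikN leq_addr.
rewrite /right_rel !(mx_nth_out _ iW) ?(ltnW iN)//= -?ltnNge ?(leqW qi)//.
by rewrite mul0r !mulr0 addr0.
Qed.

Lemma mx_nthD i j W1 W2 : mx_nth (W1 + W2) i j = mx_nth W1 i j + mx_nth W2 i j.
Proof. by rewrite /mx_nth mxE. Qed.

Lemma mx_nthZ i j a W : mx_nth (a *: W) i j = a * mx_nth W i j.
Proof. by rewrite /mx_nth mxE. Qed.

Lemma mx_nth0 i j : mx_nth (0 : 'M[R]_N.+1) i j = 0.
Proof. by rewrite /mx_nth mxE. Qed.

Lemma left_relD i c1 c2 W1 W2 : left_rel i c1 W1 -> left_rel i c2 W2 -> left_rel i (c1 + c2) (W1 + W2).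
Proof. by move=> [a1 b1] [a2 b2]; rewrite /left_rel !mx_nthD a1 a2 b1 b2; split; ring. Qed.

Lemma left_relZ i a c W : left_rel i c W -> left_rel i (a * c) (a *: W).
Proof. by move=> [a1 b1]; rewrite /left_rel !mx_nthZ a1 b1; split; ring. Qed.

Lemma right_relD i k c1 c2 W1 W2 : right_rel i k c1 W1 -> right_rel i k c2 W2 -> right_rel i k (c1 + c2) (W1 + W2).
Proof. by move=> [a1 b1] [a2 b2]; rewrite /right_rel !mx_nthD a1 a2 b1 b2; split; ring. Qed.

Lemma right_relZ i k a c W : right_rel i k c W -> right_rel i k (a * c) (a *: W).
Proof. by move=> [a1 b1]; rewrite /right_rel !mx_nthZ a1 b1; split; ring. Qed.

Lemma left_rel_sum i a b (c : nat -> R) (W : nat -> 'M[R]_N.+1) :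
  (forall j, (a <= j < b)%N -> left_rel i (c j) (W j)) ->
  left_rel i (\sum_(a <= j < b) c j) (\sum_(a <= j < b) W j).
Proof.
move=> H; rewrite big_nat [X in left_rel _ _ X]big_nat.
elim/big_ind2 : _ => [|c1 W1 c2 W2|j]; last exact: H.
- by rewrite /left_rel !mx_nth0 mul0r !mulr0 addr0.
- exact: left_relD.
Qed.

Lemma right_rel_sum i k a b (c : nat -> R) (W : nat -> 'M[R]_N.+1) :
  (forall j, (a <= j < b)%N -> right_rel i k (c j) (W j)) ->
  right_rel i k (\sum_(a <= j < b) c j) (\sum_(a <= j < b) W j).
Proof.
move=> H; rewrite big_nat [X in right_rel _ _ _ X]big_nat.
elim/big_ind2 : _ => [|c1 W1 c2 W2|j]; last exact: H.
- by rewrite /right_rel !mx_nth0 mul0r !mulr0 addr0.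
- exact: right_relD.
Qed.

Definition mean_mx (c : nat -> R) M : 'M[R]_N.+1 :=
  \sum_(1 <= i < M) (c i - c i.+1) *: zext (invmx (psub y (seg N.+1 1 i)))
  + c M *: invmx y
  + \sum_(M.+1 <= i < N.+2) (c i - c i.-1) *: zext (invmx (psub y (seg N.+1 i N.+1))).

Lemma block_inv_segl j : (0 < j)%N -> block_inv 0 j.-1 (zext (invmx (psub y (seg N.+1 1 j)))).
Proof. by case: j => // j _; exact: block_inv_seg. Qed.

Lemma block_inv_segr j : (0 < j)%N -> block_inv j.-1 N (zext (invmx (psub y (seg N.+1 j N.+1)))).
Proof. by case: j => // j _; exact: block_inv_seg. Qed.

(** The blocks that contain the vertex [i] are the leading ones ending at [i] or later
    and the whole path; the sum of their coefficients telescopes. *)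
Lemma mean_mx_left c m i : (m <= N)%N -> (i < m)%N -> left_rel i (c i.+1) (mean_mx c m.+1).
Proof.
move=> mN im; have iN : (i < N)%N by exact: leq_trans mN.
have -> : c i.+1 = \sum_(1 <= j < m.+1) (c j - c j.+1) * (i <= j.-1)%:R
    + c m.+1 * (i <= N)%:R + \sum_(m.+2 <= j < N.+2) (c j - c j.-1) * 0.
  rewrite (ltnW iN) mulr1 [X in _ + X]big1 ?addr0; last by move=> j _; rewrite mulr0.
  rewrite (@big_cat_nat _ _ _ i.+1)//=; last exact: ltnW.
  rewrite [X in X + _ + _]big_nat [X in X + _ + _]big1 ?add0r; last first.
    by move=> j /andP[j0 ji]; rewrite leqNgt (_ : (j.-1 < i)%N) ?mulr0//; lia.
  rewrite (_ : \sum_(i.+1 <= j < m.+1) _ = \sum_(i.+1 <= j < m.+1) ((- c j.+1) - (- c j))).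
    by rewrite telescope_sumr ?ltnS ?(ltnW im)//; ring.
  apply: eq_big_nat => j /andP[ij jm].
  by rewrite (_ : (i <= j.-1)%N) ?mulr1; [ring|lia].
apply: left_relD; first apply: left_relD.
- apply: left_rel_sum => j /andP[j1 jm]; apply: left_relZ; apply: left_rel_inv => //; last by lia.
  exact: block_inv_segl.
- by apply: left_relZ; apply: left_rel_inv => //; exact: block_inv_whole.
- apply: left_rel_sum => j /andP[j1 jm]; apply: left_relZ; apply: (@left_rel_out _ j.-1) => //; last by lia.
  by apply: block_inv_segr; lia.
Qed.

Lemma mean_mx_right c m i k : (m <= i)%N -> (i.+1 + k = N)%N ->
  right_rel i k (c i.+2) (mean_mx c m.+1).
Proof.
move=> mi ikN; have iN : (i < N)%N by rewrite -ikN leq_addr.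
have -> : c i.+2 = \sum_(1 <= j < m.+1) (c j - c j.+1) * 0
    + c m.+1 * (0 <= i.+1)%:R + \sum_(m.+2 <= j < N.+2) (c j - c j.-1) * (j.-1 <= i.+1)%:R.
  rewrite /= mulr1 [X in X + _ + _]big1 ?add0r; last by move=> j _; rewrite mulr0.
  rewrite (@big_cat_nat _ _ _ i.+3)//=; last first.
    by lia.
  rewrite [X in _ + (_ + X)]big_nat [X in _ + (_ + X)]big1 ?addr0; last first.
    by move=> j /andP[j0 ji]; rewrite leqNgt (_ : (i.+1 < j.-1)%N) ?mulr0//; lia.
  rewrite big_add1 /= (_ : \sum_(m.+1 <= j < i.+2) _ = \sum_(m.+1 <= j < i.+2) (c j.+1 - c j)).
    by rewrite telescope_sumr ?ltnS//; [ring|lia].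
  apply: eq_big_nat => j /andP[ij jm] /=.
  by rewrite (_ : (j <= i.+1)%N) ?mulr1//; lia.
apply: right_relD; first apply: right_relD.
- apply: right_rel_sum => j /andP[j1 jm]; apply: right_relZ; apply: (@right_rel_out _ _ j.-1) => //; last by lia.
  exact: block_inv_segl.
- by apply: right_relZ; apply: right_rel_inv => //; exact: block_inv_whole.
- apply: right_rel_sum => j /andP[j1 jm]; apply: right_relZ; apply: right_rel_inv => //.
  by apply: block_inv_segr; lia.
Qed.

Lemma mx_nth_sum i j a b (W : nat -> 'M[R]_N.+1) :
  mx_nth (\sum_(a <= k < b) W k) i j = \sum_(a <= k < b) mx_nth (W k) i j.
Proof. by rewrite /mx_nth summxE. Qed.

Lemma mean_mx_root c m k : (m + k = N)%N ->
  mx_nth (mean_mx c m.+1) m m = c m.+1 / (mdiag m - left_corr m - right_corr k m).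
Proof.
move=> mkN; have mN : (m <= N)%N by rewrite -mkN leq_addr.
rewrite !mx_nthD mx_nthZ !mx_nth_sum big_nat big1 ?add0r; last first.
  move=> j /andP[j0 jm]; rewrite mx_nthZ (mx_nth_out _ (block_inv_segl j0)) ?mulr0//; lia.
rewrite big_nat big1 ?addr0; last first.
  move=> j /andP[j0 jm]; rewrite mx_nthZ (mx_nth_out _ (block_inv_segr _)) ?mulr0//; lia.
have p0 := PG_root_pivot_gt0 mkN; congr (_ * _).
by apply: (mulfI (lt0r_neq0 p0)); rewrite inv_root// mulfV// lt0r_neq0.
Qed.

Lemma right_rels_mean_mx c m k i : (m <= i)%N -> (i + k = N)%N ->
  right_rels mdiag moff (fun j => c j.+1) (fun j => mx_nth (mean_mx c m.+1) j j)
    (fun j => mx_nth (mean_mx c m.+1) j j.+1) k i.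
Proof.
elim: k i => [//|k IH] i mi ikN /=; have ikN' : (i.+1 + k = N)%N by rewrite addSnnS.
by have [E1 E2] := mean_mx_right c mi ikN'; split=> //; apply: IH => //; exact: ltnW.
Qed.

End Elimination.

(** * The cone of positive incomplete matrices *)

Section PositiveCone.
Context {R : realType} (N : nat).
Implicit Types (y : 'M[R]_N.+1) (eta : IG R N.+1).

Definition eta_diag eta (j : nat) : R := nth 0 eta.1 j.
Definition eta_off eta (j : nat) : R := nth 0 eta.2 j.

Definition cone : set (IG R N.+1) :=
  [set eta | (forall j, (j <= N)%N -> 0 < eta_diag eta j) /\
             (forall j, (j < N)%N -> eta_off eta j ^+ 2 < eta_diag eta j * eta_diag eta j.+1)].

Lemma entry_sym eta u v : entry eta u v = entry eta v u.
Proof.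
by rewrite /entry eq_sym; case: eqVneq => [->//|_]; rewrite /edge andbC minnC.
Qed.

Lemma mx_of_IG_sym eta : (mx_of_IG eta)^T = mx_of_IG eta.
Proof. by apply/matrixP => u v; rewrite !mxE entry_sym. Qed.

Lemma entry_out eta u v : ~~ edge u v -> entry eta u v = 0.
Proof.
rewrite /entry; case: eqVneq => [->|_]; last by case: ifP.
by rewrite /edge leqnSn.
Qed.

Lemma mx_nth_diag eta j : (j <= N)%N -> mx_nth (mx_of_IG eta) j j = eta_diag eta j.
Proof. by move=> jN; rewrite /mx_nth mxE /entry eqxx (tnth_nth 0) inordK. Qed.

Lemma mx_nth_off eta j : (j < N)%N -> mx_nth (mx_of_IG eta) j j.+1 = eta_off eta j.
Proof.
move=> jN; rewrite /mx_nth mxE /entry -(inj_eq val_inj) /edge /= !inordK ?ltnS ?(ltnW jN)//.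
by rewrite (ltn_eqF (ltnSn j)) leqnn leqW//= (minn_idPl (leqnSn j)).
Qed.

Lemma pairing_tr y eta : pairing y eta = \tr (y *m mx_of_IG eta).
Proof.
rewrite /pairing big_mkcond -(pair_bigA _ (fun u v : 'I_N.+1 =>
  if edge u v then y u v * entry eta u v else 0)) /=.
apply: eq_bigr => u _; rewrite mxE; apply: eq_bigr => v _; rewrite mxE entry_sym.
by case: ifPn => // uv; rewrite entry_sym (entry_out eta uv) mulr0.
Qed.

Lemma pairingE y eta : ZG y ->
  pairing y eta = \sum_(0 <= j < N.+1) mdiag y j * eta_diag eta j +
     2 * \sum_(0 <= j < N) moff y j * eta_off eta j.
Proof.
move=> yZ; rewrite pairing_tr /mxtrace.
have -> : \sum_(i < N.+1) (y *m mx_of_IG eta) i i = \sum_(0 <= j < N.+1)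
   ((if j is j'.+1 then moff y j' * eta_off eta j' else 0) + mdiag y j * eta_diag eta j +
   (if (j < N)%N then moff y j * eta_off eta j else 0)).
  rewrite big_mkord; apply: eq_bigr => i _.
  have iN : (i <= N)%N by rewrite -ltnS.
  rewrite -{1 2}(inord_val i) (ZG_row_mul yZ)//.
  rewrite (mx_nth_diag _ iN); congr (_ + _ + _).
    by case: (nat_of_ord i) iN => [//|i'] iN; rewrite mx_nth_off.
  case: ifP => // iN'.
  by rewrite mx_nth_sym ?mx_of_IG_sym// mx_nth_off.
rewrite !big_split /= big_nat_recl//= add0r [X in _ + _ + X]big_nat_recr//= ltnn addr0.
rewrite [X in _ + _ + X](_ : _ = \sum_(0 <= j < N) moff y j * eta_off eta j); first by ring.
by apply: eq_big_nat => j /andP[_ ->].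
Qed.

(** By induction the partial sum over the first [k] vertices is at least
    [- left_corr k * a_k]; each step is the positivity of a binary quadratic form,
    whose discriminant condition is [b_k^2 <= a_k a_(k+1)]. *)
Lemma cone_form_ge0 y (a b : nat -> R) : PG y ->
  (forall j, (j <= N)%N -> 0 < a j) ->
  (forall j, (j < N)%N -> b j ^+ 2 <= a j * a j.+1) ->
  0 <= \sum_(0 <= j < N.+1) mdiag y j * a j + 2 * \sum_(0 <= j < N) moff y j * b j.
Proof.
move=> yP a0 ba.
have H k : (k <= N)%N -> - (left_corr (mdiag y) (moff y) k * a k) <=
   \sum_(0 <= j < k) mdiag y j * a j + 2 * \sum_(0 <= j < k) moff y j * b j.
  elim: k => [|k IH] kN; first by rewrite !big_geq//= mul0r mulr0 oppr0 addr0.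
  have {}IH := IH (ltnW kN).
  rewrite !big_nat_recr//=; have l0 := PG_left_pivot_gt0 yP (ltnW kN).
  set l := mdiag y k - left_corr _ _ k in l0 *; set z := moff y k.
  suff : - (z ^+ 2 / l * a k.+1) <= l * a k + 2 * (z * b k).
    by rewrite /l; lra.
  rewrite -subr_ge0 -(pmulr_rge0 _ l0).
  rewrite [X in 0 <= X](_ : _ = (l ^+ 2 * a k + 2 * l * z * b k + z ^+ 2 * a k.+1)); last first.
    by field; rewrite gt_eqF.
  rewrite -(pmulr_rge0 _ (a0 _ kN)).
  rewrite [X in 0 <= X](_ : _ = (z * a k.+1 + l * b k) ^+ 2 + l ^+ 2 * (a k * a k.+1 - b k ^+ 2)).
    by rewrite addr_ge0 ?sqr_ge0// mulr_ge0 ?sqr_ge0// subr_ge0 ba.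
  by ring.
have {H} := H N (leqnn N); rewrite big_nat_recr//= => H.
have : 0 <= (mdiag y N - left_corr (mdiag y) (moff y) N) * a N.
  by rewrite mulr_ge0// ltW// ?PG_left_pivot_gt0// a0.
by lra.
Qed.

Lemma closure_PG_ge0 (L : 'M[R]_N.+1 -> R) : continuous L ->
  (forall y, PG y -> 0 <= L y) -> forall y, closure (@PG R N.+1) y -> 0 <= L y.
Proof.
move=> cL L0 y; rewrite closureE => /(_ (L @^-1` [set x | 0 <= x])); apply; split.
  by apply: preimage_closed; [move=> x _; exact: cL|exact: closed_ge].
by move=> x /L0.
Qed.

Lemma continuous_addf (T : topologicalType) (f g : T -> R) :
  continuous f -> continuous g -> continuous (fun x => f x + g x).
Proof. by move=> cf cg x; exact: (cvgD (cf x) (cg x)). Qed.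

Lemma continuous_scalef (T : topologicalType) (c : R) (f : T -> R) :
  continuous f -> continuous (fun x => c * f x).
Proof. by move=> cf x; exact: (cvgM (cvg_cst c) (cf x)). Qed.

Lemma continuous_sumf (T : topologicalType) (I : Type) (r : seq I) (P : pred I) (F : I -> T -> R) :
  (forall i, continuous (F i)) -> continuous (fun x => \sum_(i <- r | P i) F i x).
Proof.
move=> cF; elim: r => [|i r IH].
  rewrite (_ : (fun x => _) = fun=> 0); last by apply/funext => x; rewrite big_nil.
  by move=> x; exact: cvg_cst.
rewrite (_ : (fun x => _) = fun x => (if P i then F i x else 0) + \sum_(i <- r | P i) F i x).
  apply: continuous_addf => //; case: (P i) => //.
  by move=> x; exact: cvg_cst.
by apply/funext => x; rewrite big_cons; case: ifP; rewrite ?add0r.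
Qed.

Lemma continuous_entry u v : continuous (fun y : 'M[R]_N.+1 => y u v).
Proof. exact: coord_continuous. Qed.

Lemma continuous_pairing eta : continuous (fun y => pairing y eta).
Proof.
apply: continuous_sumf => p.
rewrite (_ : (fun y => _) = fun y : 'M[R]_N.+1 => entry eta p.1 p.2 * y p.1 p.2).
  exact/continuous_scalef/continuous_entry.
by apply/funext => y; rewrite mulrC.
Qed.

(** A vector supported by an edge: its square is a boundary point of the cone of
    positive definite matrices in [ZG], and its quadratic form tests a 2 by 2 block. *)
Definition edgevec (u v : 'I_N.+1) (e : R) : 'cV[R]_N.+1 := delta_mx u 0 + e *: delta_mx v 0.

Lemma edgevec_form (A : 'M[R]_N.+1) u v e :
  ((edgevec u v e)^T *m A *m edgevec u v e) 0 0 =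
  A u u + e * (A u v + A v u) + e ^+ 2 * A v v.
Proof.
have -> : (edgevec u v e)^T = delta_mx 0 u + e *: delta_mx 0 v.
  by rewrite /edgevec linearD /= linearZ /= !trmx_delta.
rewrite -mulmxA /edgevec mulmxDr -scalemxAr -!colE mulmxDl -scalemxAl -!rowE !mxE.
by ring.
Qed.

Lemma edgevec_neq0 u v e : u != v \/ e = 0 -> edgevec u v e != 0.
Proof.
move=> uv; apply/negP => /eqP/matrixP/(_ u 0); rewrite !mxE !eqxx /=.
case: uv => [/negbTE ->|->]; rewrite ?mulr0 ?mul0r addr0 => /eqP; rewrite oner_eq0//.
Qed.

Lemma PG_form_ge0 y u v (e : R) : PG y -> u != v \/ e = 0 ->
  0 <= y u u + e * (y u v + y v u) + e ^+ 2 * y v v.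
Proof.
by move=> [_ yP] uv; rewrite -edgevec_form; apply/ltW/yP/edgevec_neq0.
Qed.

(** The defining inequalities are strict and finite in number, so the off-diagonal
    entries can be enlarged a little. *)
Lemma cone_slack eta : cone eta -> exists2 d : R, 0 < d & forall j, (j < N)%N ->
    ((1 + d) * eta_off eta j) ^+ 2 <= eta_diag eta j * eta_diag eta j.+1.
Proof.
move=> [a0 ba].
have [d /andP[d0 d1] Hd] : exists2 d : R, 0 < d <= 1 & forall j, (j < N)%N ->
    d * (3 * eta_off eta j ^+ 2 + 1) <= eta_diag eta j * eta_diag eta j.+1 - eta_off eta j ^+ 2.
  have : (N <= N)%N by []. move: {1 3}N => k.
  elim: k => [|k IH] kN; first by exists 1 => //; rewrite ltr01/=.
  have [d /andP[d0 d1] Hd] := IH (ltnW kN).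
  pose e := (eta_diag eta k * eta_diag eta k.+1 - eta_off eta k ^+ 2) / (3 * eta_off eta k ^+ 2 + 1).
  have B0 i : 0 < 3 * eta_off eta i ^+ 2 + 1 by rewrite ltr_wpDl// mulr_ge0// sqr_ge0.
  have e0 : 0 < e by rewrite divr_gt0// subr_gt0 ba.
  exists (Num.min d e); first by rewrite lt_min d0 e0 ge_min d1.
  move=> j; rewrite ltnS leq_eqVlt => /predU1P[->|jk].
    rewrite -ler_pdivlMr// -/e ge_min lexx orbT//.
  apply: le_trans (Hd j jk); rewrite ler_wpM2r ?(ltW (B0 j))// ge_min lexx//.
exists d => // j jN; have := Hd j jN; have b2 := sqr_ge0 (eta_off eta j).
rewrite exprMn; set B := eta_off eta j ^+ 2 in b2 *; set A := eta_diag eta j * _ => H.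
(* This is where [d <= 1] is used. *)
have : (1 + d) ^+ 2 * B <= (1 + 3 * d) * B by rewrite ler_wpM2r//; nra.
by nra.
Qed.

(** The slack turns the nonnegativity of the pairing on [PG] into the lower bound
    [d * sum_u y_uu a_u], up to the factor [1 + d].  The bound passes to the closure,
    where a nonzero matrix has a positive diagonal entry. *)
Lemma cone_sub_QG : cone `<=` @QG R N.+1.
Proof.
move=> eta ceta y cy y0; have [a0 ba] := ceta.
have cd := @continuous_entry.
have yuv u v e : u != v \/ e = 0 -> 0 <= y u u + e * (y u v + y v u) + e ^+ 2 * y v v.
  move=> uv; apply: (closure_PG_ge0
     (L := fun y => y u u + e * (y u v + y v u) + e ^+ 2 * y v v) _ _ cy) => [|y' yP]; last exact: PG_form_ge0.
  apply: continuous_addf; last exact: continuous_scalef.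
  by apply: continuous_addf => //; apply: continuous_scalef; exact: continuous_addf.
have yuu u : 0 <= y u u.
  by have := yuv u u 0 (or_intror erefl); rewrite mul0r expr0n mul0r !addr0.
have yle u v : y u v <= y v u.
  rewrite -subr_ge0; apply: (closure_PG_ge0 (L := fun y => y v u - y u v) _ _ cy) => [|y' yP].
    by move=> x; exact: (cvgB (cd v u x) (cd u v x)).
  by rewrite (ZG_sym yP.1) subrr.
have ysym u v : y u v = y v u by apply/eqP; rewrite eq_le !yle.
have [d d0 Hd] := cone_slack ceta.
have H : 0 <= (1 + d) * pairing y eta - d * \sum_(u < N.+1) y u u * eta_diag eta u.
  apply: (closure_PG_ge0 (L := fun y => (1 + d) * pairing y eta - d * \sum_(u < N.+1) y u u * eta_diag eta u) _ _ cy).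
    have c1 := @continuous_scalef _ (1 + d) _ (@continuous_pairing eta).
    have c2 : continuous (fun y : 'M[R]_N.+1 => d * \sum_(u < N.+1) y u u * eta_diag eta u).
      apply: continuous_scalef; apply: continuous_sumf => u.
      rewrite (_ : (fun y => _) = fun y : 'M[R]_N.+1 => eta_diag eta u * y u u).
        exact/continuous_scalef/cd.
      by apply/funext => y'; rewrite mulrC.
    by move=> x; exact: (cvgB (c1 x) (c2 x)).
  move=> y' yP; have := cone_form_ge0 yP a0 Hd; rewrite pairingE//; last by case: yP.
  rewrite (big_mkord _ (fun j => mdiag y' j * eta_diag eta j)) /=.
  have -> : \sum_(0 <= j < N) moff y' j * ((1 + d) * eta_off eta j) =
     (1 + d) * \sum_(0 <= j < N) moff y' j * eta_off eta j.
    by rewrite mulr_sumr; apply: eq_bigr => j _; rewrite mulrCA.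
  have -> : \sum_(u < N.+1) y' u u * eta_diag eta u = \sum_(i < N.+1) mdiag y' i * eta_diag eta i.
    by apply: eq_bigr => i _; rewrite /mdiag mx_nth_ord.
  lra.
have [[u u0]|nu] := pselect (exists u, 0 < y u u).
  have au (v : 'I_N.+1) : 0 < eta_diag eta v by apply: a0; rewrite -ltnS.
  have S0 : 0 < \sum_(u < N.+1) y u u * eta_diag eta u.
    rewrite (bigD1 u)//= ltr_pwDl//; first exact: mulr_gt0.
    by apply: sumr_ge0 => v _; rewrite mulr_ge0// ltW.
  have d10 : 0 < 1 + d by rewrite addr_gt0.
  rewrite -(pmulr_rgt0 _ d10); apply: lt_le_trans (_ : d * \sum_(u < N.+1) y u u * eta_diag eta u <= _).
    by rewrite mulr_gt0.
  by rewrite -subr_ge0.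
have y00 u : y u u = 0.
  apply/eqP; rewrite eq_le yuu andbT leNgt; apply/negP => u0; apply: nu; by exists u.
case/negP: y0; apply/eqP/matrixP => u v; rewrite mxE.
have [->//|uv] := eqVneq u v.
have := yuv u v 1 (or_introl uv); have := yuv u v (- 1) (or_introl uv).
by rewrite !y00 (ysym v u); lra.
Qed.

(** Adding a small multiple of the identity makes the matrix positive definite. *)
Lemma rank1_closure (x : 'cV[R]_N.+1) :
  (forall u v, x u 0 * x v 0 != 0 -> edge u v) -> closure (@PG R N.+1) (x *m x^T).
Proof.
move=> xe B nB.
have c : x *m x^T + t *: 1%:M @[t --> (0 : R)^'+] --> x *m x^T.
  rewrite -[X in _ --> X]addr0 -(scale0r 1%:M); apply: cvgD; first exact: cvg_cst.
  by apply: cvgZr_tmp; exact: cvg_at_right_filter.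
near (0 : R)^'+ => t.
have t0 : 0 < t by [].
exists (x *m x^T + t *: 1%:M); split; last by near: t; exact: c.
split; [split|].
- by rewrite linearD /= trmx_mul trmxK linearZ /= trmx1.
- move=> u v uv; rewrite !mxE big_ord1 !mxE.
  have -> : x u 0 * x v 0 = 0 by apply/eqP; apply: contraNT uv; exact: xe.
  rewrite add0r; case: eqVneq uv => [->|_ _]; last by rewrite mulr0.
  by rewrite /edge leqnSn.
- move=> z z0.
  rewrite (_ : _ *m _ = (x^T *m z)^T *m (x^T *m z) + t *: (z^T *m z)); last first.
    by rewrite trmx_mul trmxK mulmxDr mulmxDl !mulmxA -scalemxAr -scalemxAl mulmx1.
  set w := x^T *m z.
  rewrite mxE [X in X + _](_ : _ = w 0 0 ^+ 2); last by rewrite mxE big_ord1 mxE expr2.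
  apply: ltr_wpDl; first exact: sqr_ge0.
  rewrite mxE mulr_gt0// mxE.
  have [u zu] : exists u, z u 0 != 0.
    apply: contrapT => nz; case/negP: z0; apply/eqP/matrixP => u j; rewrite ord1 mxE.
    by apply/eqP; apply/negPn/negP => zu; apply: nz; exists u.
  rewrite (bigD1 u)//= mxE ltr_pwDl//; first by rewrite -expr2 exprn_even_gt0.
  by apply: sumr_ge0 => v _; rewrite mxE -expr2 sqr_ge0.
Unshelve. all: by end_near. Qed.

Lemma QG_form_gt0 eta u v e : @QG R N.+1 eta -> edge u v -> u != v \/ e = 0 ->
  0 < entry eta u u + e * (2 * entry eta u v) + e ^+ 2 * entry eta v v.
Proof.
move=> Q uv ne; set x := edgevec u v e.
have x0 : x != 0 by exact: edgevec_neq0.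
have xw w : x w 0 != 0 -> w = u \/ w = v.
  rewrite !mxE !eqxx !andbT; have [->|_] := eqVneq w u; first by left.
  by have [->|_] := eqVneq w v; [right|rewrite mulr0 addr0 eqxx].
have vu : edge v u by rewrite /edge andbC.
have euu w : @edge N.+1 w w by rewrite /edge leqnSn.
have cl : closure (@PG R N.+1) (x *m x^T).
  apply: rank1_closure => w w'; rewrite mulf_eq0 negb_or => /andP[/xw + /xw].
  by move=> [->|->] [->|->].
have := Q _ cl; rewrite pairing_tr -mulmxA mxtrace_mulC /mxtrace big_ord1.
rewrite edgevec_form 4![mx_of_IG eta _ _]mxE (entry_sym eta v u).
rewrite (_ : entry eta u v + entry eta u v = 2 * entry eta u v); last by ring.
apply.
have xxE w : (x *m x^T) w w = x w 0 * x w 0 by rewrite mxE big_ord1 [x^T _ _]mxE.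
apply: contraNneq x0 => xx; apply/eqP/matrixP => w j; rewrite ord1 [RHS]mxE.
have /matrixP/(_ w w) := xx; rewrite xxE [RHS]mxE => /eqP.
by rewrite mulf_eq0 orbb => /eqP.
Qed.

Lemma QG_sub_cone : @QG R N.+1 `<=` cone.
Proof.
move=> eta Q.
have E i k : entry eta (inord i) (inord k) = mx_nth (mx_of_IG eta) i k by rewrite /mx_nth mxE.
have a0 j : (j <= N)%N -> 0 < eta_diag eta j.
  move=> jN; have := @QG_form_gt0 eta (inord j) (inord j) 0 Q _ (or_intror erefl).
  rewrite mul0r expr0n mul0r !addr0 E mx_nth_diag//; apply.
  by rewrite /edge leqnSn.
split => // j jN; have a1 := a0 _ jN.
(* This value of the coefficient minimises the form. *)
have := @QG_form_gt0 eta (inord j) (inord j.+1) (- (eta_off eta j / eta_diag eta j.+1)) Q.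
have jj : (inord j : 'I_N.+1) != inord j.+1.
  by rewrite -(inj_eq val_inj) /= !inordK ?ltnS ?(ltnW jN)// ltn_eqF.
have je : @edge N.+1 (inord j) (inord j.+1).
  by rewrite /edge !inordK ?ltnS ?(ltnW jN)// leqnn leqW.
move=> /(_ je (or_introl jj)); rewrite !E !mx_nth_diag ?(ltnW jN)// mx_nth_off//.
rewrite -(pmulr_rgt0 _ a1).
rewrite [X in 0 < X](_ : _ = eta_diag eta j * eta_diag eta j.+1 - eta_off eta j ^+ 2) ?subr_gt0//.
by field; rewrite gt_eqF.
Qed.

Lemma QGE : @QG R N.+1 = cone.
Proof. by apply/seteqP; split; [exact: QG_sub_cone|exact: cone_sub_QG]. Qed.

End PositiveCone.

(** * The density as a product over the edges *)

Section ProductDensity.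
Context {R : realType}.

(** The enumeration may list [u] and [v] in either order, with the same determinant. *)
Lemma det_psub2 n (A : 'M[R]_n) (B : {set 'I_n}) u v : u != v -> B = [set u; v]%SET ->
  \det (psub A B) = A u u * A v v - A u v * A v u.
Proof.
move=> uv BE.
have cB : #|B| = 2%N by rewrite BE cards2 uv.
have Bm (a : 'I_#|B|) : (enum_val a == u) || (enum_val a == v).
  by have := enum_valP a; rewrite {2}BE !inE.
rewrite /psub; move: (@enum_val_inj _ (mem B)) Bm.
move: (@enum_val _ (mem B)); rewrite cB => f fi Bm.
rewrite (expand_det_row _ 0) !big_ord_recl big_ord0 /cofactor !det_mx11 !mxE /=.
have E (i j : 'I_2) : i = j :> nat -> f i = f j by move=> /val_inj ->.
rewrite /bump /= addn0 expr0 expr1 addr0 ?(E ord0 0)// ?(E (lift 0 0) 1)// ?(E (lift ord0 0) 1)//.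
rewrite ?(E (lift ord0 ord0) 1)// ?(E (lift (lift ord0 ord0) 0) 0)//.
have f01 : f 0 != f 1 by rewrite (inj_eq fi).
have [/orP[] /eqP f0 /orP[] /eqP f1] := (Bm 0, Bm 1).
all: by move: f01; rewrite f0 f1 ?eqxx //; move=> _; ring.
Qed.

Lemma prod_powR a b (x p : nat -> R) : (forall i, (a <= i < b)%N -> 0 < x i) ->
  \prod_(a <= i < b) x i `^ p i = expR (\sum_(a <= i < b) p i * ln (x i)).
Proof.
move=> x0; rewrite (big_morph expR (@expRD R) (@expR0 R)).
by apply: eq_big_nat => i /x0 xi; rewrite /powR gt_eqF.
Qed.

Variables (N : nat).
Implicit Types (eta : IG R N.+1).

Lemma minorE eta j : (j < N)%N ->
  minor eta j.+1 j.+2 = eta_diag eta j * eta_diag eta j.+1 - eta_off eta j ^+ 2.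
Proof.
move=> jN.
have jj : (inord j : 'I_N.+1) != inord j.+1.
  by rewrite -(inj_eq val_inj) /= !inordK ?ltnS ?(ltnW jN)// ltn_eqF.
rewrite /minor (det_psub2 _ jj); last first.
  apply/setP => w; rewrite !inE -!(inj_eq val_inj) /= !inordK ?ltnS ?(ltnW jN)//.
  by apply/idP/idP; lia.
rewrite -!/(mx_nth _ _ _) !mx_nth_diag ?(ltnW jN)// (mx_nth_sym j.+1 j (mx_of_IG_sym eta)).
by rewrite mx_nth_off// expr2.
Qed.

Lemma path_density_out_cone (s y z : nat -> R) m k eta : (m + k = N)%N -> ~ cone eta ->
  path_density s y z m k 0 eta.1 eta.2 = 0.
Proof.
move=> mkN nc; apply/eqP; apply: contra_notT nc; rewrite !mulf_eq0 !negb_or => /andP[/andP[Hl Hm] Hr].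
have kn r a b c : edge_kernel r a b c != 0 -> [/\ 0 < a, 0 < c & b ^+ 2 < a * c].
  by rewrite /edge_kernel; case: ifPn => [/and3P[]//|]; rewrite eqxx.
have L j : (j < m)%N -> [/\ 0 < eta_diag eta j, 0 < eta_diag eta j.+1 & eta_off eta j ^+ 2 < eta_diag eta j * eta_diag eta j.+1].
  move=> jm; move: Hl => /prodf_neq0/(_ (Ordinal jm) isT).
  by rewrite mulf_eq0 negb_or => /andP[_ /kn].
have Rr j : (m <= j < N)%N -> [/\ 0 < eta_diag eta j.+1, 0 < eta_diag eta j & eta_off eta j ^+ 2 < eta_diag eta j.+1 * eta_diag eta j].
  move=> /andP[mj jN]; have jk : (j - m < k)%N by lia.
  move: Hr => /prodf_neq0/(_ (Ordinal jk) isT).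
  rewrite /= subnKC//.
  by rewrite mulf_eq0 negb_or => /andP[_ /kn].
have a_m : 0 < eta_diag eta m.
  by move: Hm; rewrite /gamma_fun; case: ifPn => //; rewrite eqxx.
split=> j jN.
- case: (ltngtP j m) => jm; last by rewrite jm.
  + by have [] := L _ jm.
  + case: j jm jN => // j jm jN.
    by have /Rr[] : (m <= j < N)%N by rewrite -ltnS jm.
- case: (ltnP j m) => jm; first by have [] := L _ jm.
  by have [|_ _] := Rr j; [rewrite jm|rewrite mulrC].
Qed.

Lemma edge_kernel_exp r (a b c : R) : 0 < a -> 0 < c -> b ^+ 2 < a * c ->
  edge_kernel r a b c = expR ((r - 3 / 2) * ln (a * c - b ^+ 2) + (1 - r) * ln c).
Proof.
move=> a0 c0 bac; rewrite /edge_kernel a0 c0 bac /= expRD /powR.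
by rewrite !gt_eqF// subr_gt0.
Qed.

(** An identity between exponents of [a_j] and of [a_j a_(j+1) - b_j^2], whose logarithms
    are [la j] and [lD j].  The conventions [c 0 = c (N + 2) = 0] absorb the cases where
    the root is an end of the path. *)
Lemma density_exponent (c la lD : nat -> R) m : (m <= N)%N -> c 0%N = 0 -> c N.+2 = 0 ->
  \sum_(0 <= j < m) c j.+1 * lD j + \sum_(m <= j < N) c j.+2 * lD j +
  - (\sum_(1 <= j < m) c j.-1.+1 * la j + (c m - c m.+1 + c m.+2) * la m +
     \sum_(m.+1 <= j < N) c j.+2 * la j) +
  (if N == 0%N then - la 0%N else
    \sum_(0 <= j < N) (- (3 / 2)) * lD j + \sum_(1 <= j < N) la j) =
  \sum_(0 <= j < m) ((c j.+1 - 3 / 2) * lD j + (1 - c j.+1) * la j.+1) +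
  (c m.+1 - 1) * la m +
  \sum_(m <= j < N) ((c j.+2 - 3 / 2) * lD j + (1 - c j.+2) * la j).
Proof.
move=> mN c0 cN.
have S a b (f g : nat -> R) :
    \sum_(a <= j < b) ((f j - 3 / 2) * lD j + (1 - f j) * g j) =
    \sum_(a <= j < b) f j * lD j - 3 / 2 * \sum_(a <= j < b) lD j +
    (\sum_(a <= j < b) g j - \sum_(a <= j < b) f j * g j).
  by rewrite mulr_sumr -!sumrB -big_split /=; apply: eq_bigr => j _; ring.
rewrite (S 0 m (fun j => c j.+1) (fun j => la j.+1)) (S m N (fun j => c j.+2) la) -mulr_sumr.
rewrite (@big_cat_nat _ _ _ m 0 N xpredT lD)//=.
case: m mN => [|m] mN.
  rewrite [in LHS](big_geq (leqnn 0%N))// c0; case: eqVneq => N0.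
    by rewrite N0 in cN *; rewrite !big_geq// cN; ring.
  rewrite -lt0n in N0; rewrite !(big_geq (leqnn 0%N)) ?(big_geq (leq0n 1%N)).
  rewrite [\sum_(0 <= j < N) la j]big_ltn// [\sum_(0 <= j < N) c j.+2 * la j]big_ltn//.
  by ring.
rewrite (_ : (N == 0%N) = false); last by lia.
rewrite [\sum_(1 <= j < m.+1) c j.-1.+1 * la j]big_add1 /= [\sum_(0 <= j < m.+1) la j.+1]big_nat_recr//=.
rewrite [\sum_(0 <= j < m.+1) c j.+1 * la j.+1]big_nat_recr//=.
rewrite (@big_cat_nat _ _ _ m.+1 1 N xpredT la)//= [\sum_(1 <= j < m.+1) la j]big_add1 /=.
move: mN; rewrite leq_eqVlt => /predU1P[mN|mN].
  by rewrite -mN in cN *; rewrite !(big_geq (leqnn m.+1)) (big_geq (leqnSn m.+1)) cN; ring.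
rewrite [\sum_(m.+1 <= j < N) la j]big_ltn// [\sum_(m.+1 <= j < N) c j.+2 * la j]big_ltn//.
by ring.
Qed.

Variable (s : N.+1.-tuple R).
Local Notation sc := (fun j => coef s j.+1).

Lemma coef_out j : (N.+1 < j)%N -> coef s j = 0.
Proof. by move=> jN; rewrite /coef nth_default//= size_tuple. Qed.

Lemma delta_phiE m eta : (m <= N)%N -> cone eta ->
  let la j := ln (eta_diag eta j) in
  let lD j := ln (eta_diag eta j * eta_diag eta j.+1 - eta_off eta j ^+ 2) in
  delta m.+1 s eta * phi eta = expR (
    \sum_(0 <= j < m) ((sc j - 3 / 2) * lD j + (1 - sc j) * la j.+1) +
    (sc m - 1) * la m +
    \sum_(m <= j < N) ((sc j.+1 - 3 / 2) * lD j + (1 - sc j.+1) * la j)).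
Proof.
move=> mN [a0 ba] la lD.
have D0 j : (j < N)%N -> 0 < eta_diag eta j * eta_diag eta j.+1 - eta_off eta j ^+ 2.
  by move=> jN; rewrite subr_gt0 ba.
pose D j := eta_diag eta j * eta_diag eta j.+1 - eta_off eta j ^+ 2.
have E1 : \prod_(1 <= i < m.+1) minor eta i i.+1 `^ coef s i =
    expR (\sum_(0 <= j < m) sc j * lD j).
  rewrite -(@prod_powR 0 m D sc); last by move=> i im; apply: D0; lia.
  by rewrite big_add1 /=; apply: eq_big_nat => i im; rewrite minorE//; lia.
have E2 : \prod_(m.+2 <= i < N.+2) minor eta i.-1 i `^ coef s i =
    expR (\sum_(m <= j < N) sc j.+1 * lD j).
  rewrite -(@prod_powR m N D (fun j => sc j.+1)); last by move=> i im; apply: D0; lia.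
  by rewrite !big_add1 /=; apply: eq_big_nat => i im; rewrite minorE//; lia.
have E3 : \prod_(2 <= i < m.+1) diag_entry eta i `^ coef s i.-1 =
    expR (\sum_(1 <= j < m) sc j.-1 * la j).
  rewrite -(@prod_powR 1 m (eta_diag eta) (fun j => sc j.-1)); last by move=> i im; apply: a0; lia.
  by rewrite big_add1 /=; apply: eq_big_nat => i im; rewrite prednK//; lia.
have E4 : \prod_(m.+2 <= i < N.+1) diag_entry eta i `^ coef s i.+1 =
    expR (\sum_(m.+1 <= j < N) sc j.+1 * la j).
  rewrite -(@prod_powR m.+1 N (eta_diag eta) (fun j => sc j.+1)); last by move=> i im; apply: a0; lia.
  by rewrite big_add1 /=.
have E5 (r : R) : diag_entry eta m.+1 `^ r = expR (r * la m).
  by rewrite /powR gt_eqF ?a0.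
have E6 : phi eta = expR (if N == 0%N then - la 0%N else
    \sum_(0 <= j < N) (- (3 / 2)) * lD j + \sum_(1 <= j < N) la j).
  rewrite /phi eqSS; case: eqVneq => N0.
    by rewrite expRN lnK ?posrE ?a0.
  rewrite expRD; congr (_ * _).
    rewrite -(@prod_powR 0 N D (fun=> - (3 / 2))); last by move=> i im; apply: D0; lia.
    by rewrite big_add1 /=; apply: eq_big_nat => i im; rewrite minorE//; lia.
  rewrite (big_morph expR (@expRD R) (@expR0 R)) big_add1 /=.
  by apply: eq_big_nat => i im; rewrite lnK ?posrE ?a0//; lia.
rewrite /delta E1 E2 E3 E4 E5 E6 -!expRD -expRN -!expRD; congr expR.
exact: (density_exponent (c := coef s) la lD mN erefl (coef_out (leqnn _))).
Qed.

Lemma path_densityE m k eta (y z : nat -> R) : (m + k = N)%N -> cone eta ->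
  expR (- (\sum_(0 <= j < N.+1) y j * eta_diag eta j + 2 * \sum_(0 <= j < N) z j * eta_off eta j)) *
   (delta m.+1 s eta * phi eta) = path_density sc y z m k 0 eta.1 eta.2.
Proof.
move=> mkN ceta; have mN : (m <= N)%N by rewrite -mkN leq_addr.
rewrite delta_phiE// -expRD; have [a0 ba] := ceta.
have E1 : \prod_(j < m) left_weight sc y z (0 + j) (nth 0 eta.1 j) (nth 0 eta.2 j) (nth 0 eta.1 j.+1) =
  expR (\sum_(0 <= j < m) (- (y j * eta_diag eta j) - 2 * z j * eta_off eta j +
    ((sc j - 3 / 2) * ln (eta_diag eta j * eta_diag eta j.+1 - eta_off eta j ^+ 2) + (1 - sc j) * ln (eta_diag eta j.+1)))).
  rewrite (big_morph expR (@expRD R) (@expR0 R)) big_mkord; apply: eq_bigr => j _.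
  have jN := leq_trans (ltn_ord j) mN.
  by rewrite /left_weight edge_kernel_exp ?a0 ?ba ?(ltnW jN)// -expRD.
have E2 : gamma_fun (sc (0 + m)%N) (y (0 + m)%N) (nth 0 eta.1 m) =
  expR ((sc m - 1) * ln (eta_diag eta m) - y m * eta_diag eta m).
  by rewrite /gamma_fun a0// expRD /powR gt_eqF ?a0.
have E3 : \prod_(j < k) right_weight sc y z (0 + m + j) (nth 0 eta.1 (m + j)) (nth 0 eta.2 (m + j))
                  (nth 0 eta.1 (m + j).+1) =
  expR (\sum_(m <= j < N) (- (y j.+1 * eta_diag eta j.+1) - 2 * z j * eta_off eta j +
    ((sc j.+1 - 3 / 2) * ln (eta_diag eta j * eta_diag eta j.+1 - eta_off eta j ^+ 2) + (1 - sc j.+1) * ln (eta_diag eta j)))).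
  have reidx (F : nat -> R) : \prod_(m <= j < N) F j = \prod_(j < k) F (m + j)%N.
    rewrite -{1}[m]add0n big_addn (_ : (N - m)%N = k) ?big_mkord; last by lia.
    by apply: eq_bigr => j _; rewrite addnC.
  rewrite (big_morph expR (@expRD R) (@expR0 R)) reidx.
  apply: eq_bigr => j _; have jN : (m + j < N)%N by rewrite -mkN ltn_add2l.
  rewrite /right_weight edge_kernel_exp ?a0 ?(ltnW jN)//; last by rewrite mulrC ba.
  rewrite -expRD (mulrC (eta_diag eta (m + j).+1)).
  by [].
rewrite /path_density E1 E2 E3 -!expRD; congr expR.
have S a b (p q : nat -> R) :
    \sum_(a <= j < b) (- p j - 2 * z j * eta_off eta j + q j) =
    - \sum_(a <= j < b) p j - 2 * \sum_(a <= j < b) z j * eta_off eta j + \sum_(a <= j < b) q j.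
  by rewrite mulr_sumr -sumrN -sumrB -big_split /=; apply: eq_bigr => j _; ring.
have Ya : \sum_(0 <= j < N.+1) y j * eta_diag eta j = \sum_(0 <= j < m) y j * eta_diag eta j +
    (y m * eta_diag eta m + \sum_(m <= j < N) y j.+1 * eta_diag eta j.+1).
  rewrite (@big_cat_nat _ _ _ m)//= ?(leqW mN)//; congr (_ + _).
  by rewrite big_ltn ?ltnS// big_add1.
rewrite Ya (@big_cat_nat _ _ _ m 0 N xpredT (fun j => z j * eta_off eta j))//=.
rewrite (S 0%N m (fun j => y j * eta_diag eta j)) (S m N (fun j => y j.+1 * eta_diag eta j.+1)).
by ring.
Qed.

End ProductDensity.

(** * The Wishart law and its mean *)

Section DensityMeasure.
Context d (T : measurableType d) (R : realType).
Local Open Scope ereal_scope.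

(** The Radon-Nikodym derivative is almost everywhere equal to the density. *)
Lemma integral_density (gam : {finite_measure set T -> \bar R})
  (mu : {sigma_finite_measure set T -> \bar R}) (f : T -> \bar R) :
  mu.-integrable setT f -> (forall A, measurable A -> gam A = \int[mu]_(x in A) f x) ->
  forall (E : set T) (phi : T -> \bar R), measurable E -> measurable_fun setT phi ->
  (forall x, 0 <= phi x) ->
  \int[gam]_(x in E) phi x = \int[mu]_(x in E) (phi x * f x).
Proof.
move=> fi gE E phi mE mphi phi0.
have mf : measurable_fun setT f by exact: measurable_int fi.
have dom : gam `<< mu.
  apply/null_content_dominatesP => A mA A0; rewrite gE//.
  by apply: null_set_integral => //; exact: measurable_funTS.
rewrite -(Radon_Nikodym_SigmaFinite.change_of_variables dom)//; last exact: measurable_funTS.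
have gi := Radon_Nikodym_SigmaFinite.f_integrable dom.
apply: ae_eq_integral => //.
- apply: emeasurable_funM; apply: measurable_funTS => //; exact: measurable_int gi.
- by apply: emeasurable_funM; apply: measurable_funTS.
apply: ae_eqe_mul2l; apply: integral_ae_eq => //.
- exact: integrableS gi.
- exact: measurable_funTS.
- by move=> A AE mA; rewrite -gE// (Radon_Nikodym_SigmaFinite.f_integral dom).
Qed.

Lemma probability_of_density (mu : {measure set T -> \bar R}) (f : T -> R) :
  measurable_fun setT f -> (forall x, 0 <= f x)%R -> \int[mu]_x (f x)%:E = 1 ->
  exists P : probability T R, forall A, measurable A -> P A = \int[mu]_(x in A) (f x)%:E.
Proof.
move=> mf f0 f1; pose nu A := \int[mu]_(x in A) (f x)%:E.
have fi : mu.-integrable setT (fun x => (f x)%:E).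
  apply/integrableP; split; first exact/measurable_EFinP.
  by under eq_integral do rewrite gee0_abs ?lee_fin//; rewrite f1 ltry.
have nu0 : nu set0 = 0 by rewrite /nu integral_set0.
have nu_ge0 A : 0 <= nu A by apply: integral_ge0 => x _; rewrite lee_fin.
have nu_sigma : semi_sigma_additive nu.
  move=> A mA tA mUA; rewrite /nu integral_bigcup//=; last first.
    exact: (integrableS _ _ (subsetT _)).
  apply: is_cvg_ereal_nneg_natsum_cond => n _ _.
  by apply: integral_ge0 => x _; rewrite lee_fin.
pose m : {measure set T -> \bar R} :=
  HB.pack nu (isMeasure.Build _ _ _ nu nu0 nu_ge0 nu_sigma).
pose P : probability T R :=
  HB.pack (m : set T -> \bar R) m (Measure_isProbability.Build _ _ _ m f1).
by exists P.
Qed.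
End DensityMeasure.

Section Wishart.
Context {R : realType} (m k : nat).
Local Notation N := (m + k)%N.
Variable (s : N.+1.-tuple R) (y : 'M[R]_N.+1).
Hypothesis yPG : PG y.
Local Notation sc := (fun j => coef s j.+1).
Hypothesis s_gt : forall j, (j <= N)%N -> j <> m -> 1 / 2 < sc j.
Hypothesis sm_gt0 : 0 < sc m.
Implicit Types (eta : IG R N.+1) (yy zz h g : nat -> R).

Definition wishart_dens yy zz eta : R := path_density sc yy zz m k 0 eta.1 eta.2.

Lemma measurable_wishart_dens yy zz : measurable_fun setT (wishart_dens yy zz).
Proof. by apply: measurable_path_density; [exact: measurable_fst|exact: measurable_snd]. Qed.

Lemma wishart_dens_ge0 yy zz eta : 0 <= wishart_dens yy zz eta.
Proof. exact: path_density_ge0. Qed.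

Lemma wishart_dens_out yy zz eta : ~ @QG R N.+1 eta -> wishart_dens yy zz eta = 0.
Proof. by rewrite QGE => nc; apply: path_density_out_cone. Qed.

Definition linform h g eta : R :=
  \sum_(0 <= j < N.+1) h j * eta_diag eta j + 2 * \sum_(0 <= j < N) g j * eta_off eta j.

Lemma wishart_densE yy zz eta : @QG R N.+1 eta ->
  wishart_dens yy zz eta = expR (- linform yy zz eta) * (delta m.+1 s eta * phi eta).
Proof. by rewrite QGE => ceta; rewrite /wishart_dens -path_densityE. Qed.

(** Multiplying by the exponential of a linear form amounts to moving the parameter,
    so the Laplace transform at nearby parameters gives the exponential moments. *)
Lemma wishart_dens_shift yy zz h g t eta :
  expR (- (t * linform h g eta)) * wishart_dens yy zz eta =
  wishart_dens (fun j => yy j + t * h j) (fun j => zz j + t * g j) eta.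
Proof.
have [Q|nQ] := pselect (@QG R N.+1 eta); last by rewrite !wishart_dens_out// mulr0.
rewrite !wishart_densE// mulrA -expRD; congr (expR _ * _).
have S a b (p q c : nat -> R) : \sum_(a <= j < b) (p j + t * q j) * c j =
    \sum_(a <= j < b) p j * c j + t * \sum_(a <= j < b) q j * c j.
  by rewrite mulr_sumr -big_split; apply: eq_bigr => j _; rewrite mulrDl mulrA.
by rewrite /linform !S; ring.
Qed.

(** The condition under which the density is integrable. *)
Definition admissible yy zz :=
  [/\ forall j, (j < m)%N -> 0 < yy j - left_corr yy zz j,
      0 < yy m - left_corr yy zz m - right_corr yy zz k m & right_pivots_gt0 yy zz k m].

Lemma laplace_wishart_dens : exists2 K : R, 0 < K & forall yy zz, admissible yy zz ->
  (\int[@leb_IG R N.+1]_eta (wishart_dens yy zz eta)%:E)%E = (K * expR (- log_pivots sc yy zz m k))%:E.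
Proof.
have [j /andP[_ jN] jm| |K K0 HK] := @path_density_integral R sc k m 0.
- by apply: s_gt => //; rewrite add0n in jN.
- by rewrite add0n.
exists K => // yy zz [pl pm pr].
rewrite add0n in HK.
rewrite -(HK yy zz)//.
rewrite (@integral_IG R N (fun x u => (path_density sc yy zz m k 0 x u)%:E)); last 2 first.
- by apply/measurable_EFinP; apply: measurable_path_density; [exact: measurable_fst|exact: measurable_snd].
- by move=> x u; rewrite lee_fin path_density_ge0.
apply: eq_integral => a _; apply: eq_integral => x _; apply: eq_integral => u _.
by rewrite /= mul0r expR0 mul1r.
Qed.

Lemma admissible_y : admissible (mdiag y) (moff y).
Proof.
split.
- by move=> j jm; apply: (PG_left_pivot_gt0 yPG); rewrite (leq_trans (ltnW jm))// leq_addr.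
- exact: (PG_root_pivot_gt0 yPG).
- exact: (PG_right_pivots_gt0 yPG).
Qed.

Lemma pairing_linform eta : pairing y eta = linform (mdiag y) (moff y) eta.
Proof. by rewrite pairingE//; case: yPG. Qed.

Lemma measurable_QG : measurable (@QG R N.+1).
Proof.
rewrite (_ : @QG R N.+1 = wishart_dens (mdiag y) (moff y) @^-1` [set r | 0 < r]); last first.
  apply/seteqP; split => eta /=.
    rewrite QGE => ceta; rewrite wishart_densE ?QGE// delta_phiE// ?leq_addr//.
    by rewrite -expRD expR_gt0.
  by move=> w0; apply: contrapT => nQ; rewrite wishart_dens_out ?ltxx in w0.
rewrite -[X in measurable X]setTI; apply: measurable_wishart_dens => //.
by rewrite -set_itvoy; exact: measurable_itv.
Qed.

Lemma wishart_densityE (c : R) (A : set (IG R N.+1)) : measurable A ->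
  (\int[@leb_IG R N.+1]_(eta in A `&` @QG R N.+1)
      (c * (expR (- pairing y eta) * delta m.+1 s eta * phi eta))%:E =
  \int[@leb_IG R N.+1]_(eta in A) (c * wishart_dens (mdiag y) (moff y) eta)%:E)%E.
Proof.
move=> mA; rewrite integral_mkcondr; apply: eq_integral => eta _.
rewrite patchE; case: ifPn => [|]; rewrite ?inE/= => Q; last first.
  by rewrite wishart_dens_out ?mulr0// => Q'; case/negP: Q; rewrite inE.
by rewrite (wishart_densE _ _ Q) pairing_linform !mulrA.
Qed.

Lemma exists_wishart : exists gamma : probability (IG R N.+1) R, is_wishart m.+1 s y gamma.
Proof.
have [K K0 HK] := laplace_wishart_dens.
pose L := K * expR (- log_pivots sc (mdiag y) (moff y) m k).
have L0 : 0 < L by rewrite mulr_gt0 ?expR_gt0.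
have [||//|P HP] := @probability_of_density _ _ R (@leb_IG R N.+1)
    (fun eta => L^-1 * wishart_dens (mdiag y) (moff y) eta).
- by apply: measurable_funM => //; exact: measurable_wishart_dens.
- by move=> eta; rewrite mulr_ge0 ?invr_ge0 ?wishart_dens_ge0// ltW.
- under eq_integral do rewrite EFinM.
  rewrite ge0_integralZl//.
  + by rewrite (HK _ _ admissible_y) -EFinM mulVf// gt_eqF.
  + by apply/measurable_EFinP; exact: measurable_wishart_dens.
  + by move=> eta _; rewrite lee_fin wishart_dens_ge0.
  + by rewrite lee_fin invr_ge0 ltW.
exists P; exists L^-1; first by rewrite invr_gt0.
by move=> A mA; rewrite wishart_densityE// HP.
Qed.

Lemma measurable_linform h g : measurable_fun setT (linform h g).
Proof.
have mnat (F : nat -> IG R N.+1 -> R) b : (forall j, measurable_fun setT (F j)) ->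
    measurable_fun setT (fun eta => \sum_(0 <= j < b) F j eta).
  move=> mF; elim: b => [|b IH].
    by rewrite (_ : (fun _ => _) = cst 0)//; apply/funext => e; rewrite big_geq.
  rewrite (_ : (fun _ => _) = fun eta => \sum_(0 <= j < b) F j eta + F b eta).
    exact: measurable_funD.
  by apply/funext => e; rewrite big_nat_recr.
apply: measurable_funD; first apply: mnat => j.
  by apply: measurable_funM => //; apply: measurable_nth; exact: measurable_fst.
apply: measurable_funM => //; apply: mnat => j.
by apply: measurable_funM => //; apply: measurable_nth; exact: measurable_snd.
Qed.

Section Mean.
Variable gamma : probability (IG R N.+1) R.
Hypothesis gW : is_wishart m.+1 s y gamma.

(** Moving the parameter a little keeps the pivots positive. *)
Lemma wishart_laplace yy zz h g : yy = mdiag y -> zz = moff y ->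
  \forall t \near (0 : R), (\int[gamma]_(eta in @QG R N.+1) (expR (- (t * linform h g eta)))%:E)%E =
  (expR (log_pivots sc yy zz m k - log_pivots sc (fun j => yy j + t * h j) (fun j => zz j + t * g j) m k))%:E.
Proof.
move=> -> ->.
have [K K0 HK] := laplace_wishart_dens.
have [c c0 HP] := gW.
pose f eta := (c * wishart_dens (mdiag y) (moff y) eta)%:E.
have HP' (A : set (IG R N.+1)) : measurable A -> gamma A = (\int[@leb_IG R N.+1]_(x in A) f x)%E.
  by move=> mA; rewrite HP// wishart_densityE.
have mw yy' zz' : measurable_fun setT (fun eta => (wishart_dens yy' zz' eta)%:E).
  by apply/measurable_EFinP; exact: measurable_wishart_dens.
have cint yy' zz' : admissible yy' zz' ->
   (\int[@leb_IG R N.+1]_eta (c * wishart_dens yy' zz' eta)%:E =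
     (c * (K * expR (- log_pivots sc yy' zz' m k)))%:E)%E.
  move=> ad; under eq_integral do rewrite EFinM.
  rewrite ge0_integralZl//.
  - by rewrite HK.
  - by move=> eta _; rewrite lee_fin wishart_dens_ge0.
  - by rewrite lee_fin ltW.
have c1 : c * (K * expR (- log_pivots sc (mdiag y) (moff y) m k)) = 1.
  have := HP' setT measurableT; rewrite probability_setT (cint _ _ admissible_y).
  by move=> /esym[].
have fi : (@leb_IG R N.+1).-integrable setT f.
  apply/integrableP; split.
    by apply/measurable_EFinP; apply: measurable_funM => //; exact: measurable_wishart_dens.
  have -> : (\int[@leb_IG R N.+1]_x `|f x| = \int[@leb_IG R N.+1]_x f x)%E.
    by apply: eq_integral => x _; rewrite gee0_abs// lee_fin mulr_ge0 ?wishart_dens_ge0// ltW.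
  by rewrite (cint _ _ admissible_y) ltry.
have [pl pm pr] := admissible_y.
have n1 := near_left_pivots_gt0 h g pl; have n2 := near_right_pivots_gt0 h g pr; have n3 := near_root_pivot_gt0 h g pl pr pm.
near=> t.
have ad : admissible (fun j => mdiag y j + t * h j) (fun j => moff y j + t * g j).
  by split; near: t.
rewrite (@integral_density _ _ R gamma (@leb_IG R N.+1) f fi HP'); last 3 first.
- exact: measurable_QG.
- apply/measurable_EFinP; apply: measurableT_comp => //; apply: measurableT_comp => //.
  by apply: measurable_funM => //; exact: measurable_linform.
- by move=> x; rewrite lee_fin expR_ge0.
rewrite integral_mkcond.
transitivity (\int[@leb_IG R N.+1]_eta
   (c * wishart_dens (fun j => mdiag y j + t * h j) (fun j => moff y j + t * g j) eta)%:E)%E.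
  apply: eq_integral => eta _; rewrite patchE; case: ifPn => [|]; rewrite ?inE/= => Q.
    by rewrite -EFinM mulrCA wishart_dens_shift.
  by rewrite wishart_dens_out ?mulr0// => Q'; case/negP: Q; rewrite inE.
rewrite cint//; congr EFin.
rewrite expRD -[RHS]mul1r -c1 -!mulrA; do 2 congr (_ * _).
by rewrite mulrA -expRD addNr expR0 mul1r.
Unshelve. all: by end_near. Qed.

(** The function [phi] below is the Laplace transform of the linear form; it lies above
    the line of slope minus the mean. *)
Lemma wishart_linform h g :
  gamma.-integrable (@QG R N.+1) (fun eta => (linform h g eta)%:E) /\
  \int[gamma]_(eta in @QG R N.+1) linform h g eta =
  \sum_(0 <= j < N.+1) h j * mx_nth (mean_mx y (coef s) m.+1) j j +
  2 * \sum_(0 <= j < N) g j * mx_nth (mean_mx y (coef s) m.+1) j j.+1.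
Proof.
pose phi t := expR (log_pivots sc (mdiag y) (moff y) m k -
   log_pivots sc (fun j => mdiag y j + t * h j) (fun j => moff y j + t * g j) m k).
have Hphi : \forall t \near (0 : R),
   (\int[gamma]_(eta in @QG R N.+1) (expR (- (t * linform h g eta)))%:E)%E = (phi t)%:E.
  exact: wishart_laplace.
have mQ := measurable_QG.
have me t : measurable_fun setT (fun eta => expR (- (t * linform h g eta))).
  apply: measurableT_comp => //; apply: measurableT_comp => //.
  by apply: measurable_funM => //; exact: measurable_linform.
have ei t : (\int[gamma]_(eta in @QG R N.+1) (expR (- (t * linform h g eta)))%:E)%E = (phi t)%:E ->
    gamma.-integrable (@QG R N.+1) (fun eta => (expR (- (t * linform h g eta)))%:E).
  move=> E; apply/integrableP; split; first by apply/measurable_EFinP; exact: measurable_funTS.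
  by under eq_integral do rewrite gee0_abs ?lee_fin ?expR_ge0//; rewrite E ltry.
have phi0 : phi 0 = 1.
  rewrite /phi (_ : (fun j => mdiag y j + 0 * h j) = mdiag y); last first.
    by apply/funext => j; rewrite mul0r addr0.
  rewrite (_ : (fun j => moff y j + 0 * g j) = moff y); last first.
    by apply/funext => j; rewrite mul0r addr0.
  by rewrite subrr expR0.
have Q1 : gamma (@QG R N.+1) = 1%E.
  have := nbhs_singleton Hphi; rewrite phi0 => <-.
  under eq_integral do rewrite mul0r oppr0 expR0.
  by rewrite integral_cst// mul1e.
have Xi : gamma.-integrable (@QG R N.+1) (fun eta => (linform h g eta)%:E).
  have [e /= e0 He] := Hphi.
  pose t := e / 2; have t0 : 0 < t by rewrite divr_gt0.
  have te : t < e by rewrite /t ltr_pdivrMr// mulr_natr mulr2n ltrDl.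
  have i1 := ei t (He _ _); have i2 := ei (- t) (He _ _).
  have {}i1 : gamma.-integrable (@QG R N.+1) (fun eta => (expR (- (t * linform h g eta)))%:E).
    by apply: i1; rewrite /= sub0r normrN gtr0_norm.
  have {}i2 : gamma.-integrable (@QG R N.+1) (fun eta => (expR (- (- t * linform h g eta)))%:E).
    by apply: i2; rewrite /= sub0r opprK gtr0_norm.
  (* [t |X| <= exp (t X) + exp (- t X)]. *)
  have i3 := integrableZl mQ t^-1 (integrableD mQ i1 i2).
  apply: le_integrable i3 => //.
    by apply/measurable_EFinP; apply: measurable_funTS; exact: measurable_linform.
  move=> eta _ /=; rewrite lee_fin; set X := linform h g eta.
  rewrite [leRHS]ger0_norm; last by rewrite mulr_ge0 ?invr_ge0 ?addr_ge0 ?expR_ge0// ltW.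
  rewrite -ler_pdivrMl ?invr_gt0// invrK -(gtr0_norm t0) -normrM (gtr0_norm t0).
  have a1 := expR_ge1Dx (- (t * X)); have a2 := expR_ge1Dx (- (- t * X)).
  have a3 := expR_ge0 (- (t * X)); have a4 := expR_ge0 (- (- t * X)).
  by rewrite ler_norml; apply/andP; split; lra.
split=> //; set E := \int[gamma]_(eta in _) _.
have dphi : is_derive (0 : R) 1 phi (- (
  \sum_(0 <= j < N.+1) h j * mx_nth (mean_mx y (coef s) m.+1) j j +
  2 * \sum_(0 <= j < N) g j * mx_nth (mean_mx y (coef s) m.+1) j j.+1)).
  have [pl pm pr] := admissible_y.
  have dG := @is_derive_log_pivots R (mdiag y) (moff y) h g sc
    (fun j => mx_nth (mean_mx y (coef s) m.+1) j j)
    (fun j => mx_nth (mean_mx y (coef s) m.+1) j j.+1) m k pl pr pm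
    (fun i im => mean_mx_left yPG (coef s) (leq_addr k m) im)
    (right_rels_mean_mx yPG (coef s) (leqnn m) erefl)
    (mean_mx_root yPG (coef s) erefl).
  have dd := is_derive_subf (is_derive_constf (log_pivots sc (mdiag y) (moff y) m k) 0) dG.
  have de := @is_derive1_comp R (@expR R) _ 0 _ _ (is_derive_expR _) dd.
  apply: (is_derive_eq de).
  by rewrite -/(phi 0) phi0 mul1r sub0r.
suff /(is_derive_supporting_line dphi phi0) : \forall t \near (0 : R), 1 - t * E <= phi t.
  by move/oppr_inj.
near=> t.
have Et : (\int[gamma]_(eta in @QG R N.+1) (expR (- (t * linform h g eta)))%:E)%E = (phi t)%:E.
  by near: t.
have -> : phi t = \int[gamma]_(eta in @QG R N.+1) expR (- (t * linform h g eta)).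
  by rewrite /Rintegral Et.
have ic : gamma.-integrable (@QG R N.+1) (EFin \o cst (1 : R)).
  by apply: finite_measure_integrable_cst.
have iX : gamma.-integrable (@QG R N.+1) (EFin \o (fun eta => t * linform h g eta)).
  exact: (integrableZl mQ t Xi).
have -> : 1 - t * E = \int[gamma]_(eta in @QG R N.+1) (1 - t * linform h g eta).
  rewrite (RintegralB mQ ic iX) RintegralZl//; congr (_ - _).
  transitivity (1 * fine (gamma (@QG R N.+1))); first by rewrite Q1 mul1r.
  exact/esym/Rintegral_cst.
apply: le_Rintegral => //.
- exact: (integrableB mQ ic iX).
- exact: ei.
- by move=> eta _; rewrite expR_ge1Dx.
Unshelve. all: by end_near. Qed.

End Mean.
End Wishart.

Lemma sum_indic_nat {R : realType} (b u : nat) (f : nat -> R) : (u < b)%N ->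
  \sum_(0 <= j < b) (j == u)%:R * f j = f u.
Proof.
move=> ub; rewrite big_mkord (bigD1 (Ordinal ub))//= eqxx mul1r big1 ?addr0// => j ju.
by rewrite (_ : (j == u :> nat) = false) ?mul0r//; apply: contra_neqF ju => /eqP e; exact/val_inj.
Qed.

Theorem proposition3 (R : realType) (n M : nat) (s : n.-tuple R)
  (n_ge1 : (1 <= n)%N) (M_bounds : (1 <= M <= n)%N)
  (s_gt : forall i : nat, (1 <= i <= n)%N -> i <> M -> 1 / 2 < coef s i)
  (sM_gt0 : 0 < coef s M)
  (y : 'M[R]_n) (y_PG : PG y) :
  (exists gamma : probability (IG R n) R, is_wishart M s y gamma) /\
  (forall gamma : probability (IG R n) R, is_wishart M s y gamma ->
    has_mean gamma /\
    mean gamma =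
      piG (\sum_(1 <= i < M)
             (coef s i - coef s i.+1) *: zext (invmx (psub y (seg n 1 i)))
           + coef s M *: invmx y
           + \sum_(M.+1 <= i < n.+1)
             (coef s i - coef s i.-1) *: zext (invmx (psub y (seg n i n))))).
Proof.
case: M M_bounds s_gt sM_gt0 => [//|m] /andP[_ mn] s_gt sM_gt0.
have [k nE] : exists k, n = (m + k).+1 by exists (n - m.+1)%N; lia.
subst n.
have sg j : (j <= m + k)%N -> j <> m -> 1 / 2 < coef s j.+1.
  by move=> jN jm; apply: s_gt => //; case=> /jm.
split; first exact: exists_wishart.
move=> gamma gW.
pose F := mean_mx y (coef s) m.+1.
have Q := wishart_linform y_PG sg sM_gt0 gW.
have diag (u : 'I_(m + k).+1) :
    gamma.-integrable (@QG R (m + k).+1) (fun eta => (entry eta u u)%:E) /\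
    \int[gamma]_(eta in @QG R (m + k).+1) entry eta u u = F u u.
  have [] := Q (fun j => (j == u)%:R) (fun=> 0).
  have E : linform (fun j => (j == u)%:R) (fun=> 0) = (fun eta : IG R (m + k).+1 => entry eta u u).
    apply/funext => eta; rewrite /linform sum_indic_nat// [X in _ + 2 * X]big1 ?mulr0 ?addr0; last by move=> *; rewrite mul0r.
    by rewrite /entry eqxx (tnth_nth 0).
  rewrite E sum_indic_nat// [X in _ + 2 * X]big1 ?mulr0 ?addr0; last by move=> *; rewrite mul0r.
  by rewrite mx_nth_ord.
have off (u v : 'I_(m + k).+1) : v = u.+1 :> nat ->
    gamma.-integrable (@QG R (m + k).+1) (fun eta => (entry eta u v)%:E) /\
    \int[gamma]_(eta in @QG R (m + k).+1) entry eta u v = F u v.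
  move=> vu; have uN : (u < m + k)%N by rewrite -ltnS -vu.
  have [] := Q (fun=> 0) (fun j => (j == u)%:R / 2).
  have S (f : nat -> R) : \sum_(0 <= j < m + k) (j == u)%:R / 2 * f j = f u / 2.
    rewrite -[RHS](sum_indic_nat (fun j => f j / 2) uN).
    by apply: eq_bigr => j _; rewrite -!mulrA (mulrC _ (f j)).
  have E : linform (fun=> 0) (fun j => (j == u)%:R / 2) = (fun eta : IG R (m + k).+1 => entry eta u v).
    apply/funext => eta; rewrite /linform S big1 ?add0r; last by move=> *; rewrite mul0r.
    rewrite mulrC divfK ?pnatr_eq0// -mx_nth_off// -vu mx_nth_ord mxE//.
  rewrite E S big1 ?add0r; last by move=> *; rewrite mul0r.
  by rewrite mulrC divfK ?pnatr_eq0// -vu mx_nth_ord.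
split.
  move=> u v; rewrite /edge => /andP[uv vu].
  case: (ltngtP u v) => [uv'|uv'|/val_inj ->]; last by case: (diag v).
  - have uv1 : v = u.+1 :> nat by lia.
    by have [] := off u v uv1.
  - have vu1 : u = v.+1 :> nat by lia.
    have [+ _] := off v u vu1.
    by rewrite (_ : (fun eta => _) = fun eta : IG R (m + k).+1 => (entry eta u v)%:E)//;
      apply/funext => eta; rewrite entry_sym.
rewrite /mean /piG /IG_of; congr pair; apply: eq_from_tnth => i; rewrite !tnth_mktuple.
- by have [_ ->] := diag i.
- by have [//|_ ->] := off (edge_lo i) (edge_hi i).
Qed.
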